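(* Let $F_1,F_2:\mathbb R\to(0,\infty)$ be measurable and $\psi\in\mathcal C_0$ with $I(F_1\circ\psi,\psi),I(F_2\circ\psi^*,\psi^* )\in(0,\infty)$, such that $F_1\circ\psi$, $F_2\circ\psi^*$ and $x\mapsto\breve F(\|x\|^2/2)$ are log-concave, and assume $0<I(\breve F,1)<\infty$. Then for $p>0$, $$G_{p,F_1,F_2}(\psi)\cdot G_{p,F_2,F_1}(\psi^* )\le\Big[G_{p,\breve F,\breve F}\Big(\frac{\|\cdot\|^2}{2}\Big)\Big]^2.$$ If $\breve F$ is strictly decreasing, equality holds if and only if $\psi,\breve F,F_1,F_2$ satisfy condition (E).
   Context: $\mathcal C$ is the set of convex $\psi:\mathbb R^n\to\mathbb R\cup\{+\infty\}$ with domain of nonempty interior; $\psi^*(y)=\sup_x(\langle x,y\rangle-\psi(x))$ (so $\psi^{**}=\psi$ for lower semicontinuous $\psi$); $\nabla^2\psi$ is the Alexandrov Hessian; $X_\psi=\{x:\psi(x)<\infty,\ \nabla^2\psi(x)\text{ exists and is invertible}\}$. $I(F\circ\psi,\psi)=\int_{X_\psi}F(\psi(x))dx$, $I(g,\psi^* )=\int_{X_{\psi^*}}g$; $\mathcal L_{\psi^*}$: log-concave integrable $g>0$ on $X_{\psi^*}$ with $0<I(g,\psi^* )<\infty$. For $-n\ne p\in\mathbb R$, $V_{p,F_1,F_2}(\psi,g)=\int_{X_\psi}\big(\frac{F_2(\langle x,\nabla\psi(x)\rangle-\psi(x))}{g(\nabla\psi(x))}\big)^{p/n}F_1(\psi(x))dx$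 and $G_{p,F_1,F_2}(\psi)=\inf_{g\in\mathcal L_{\psi^*}}\{V_{p,F_1,F_2}(\psi,g)^{\frac{n}{n+p}}I(g,\psi^* )^{\frac{p}{n+p}}\}$ for $p\ge0$ ($\sup$ for $-n\ne p<0$); $G_{p,F_2,F_1}(\psi^* )$ is defined in the same way with the roles of $(\psi,F_1,F_2)$ played by $(\psi^*,F_2,F_1)$. $\breve F(t)=\sup_{(t_1+t_2)/2\ge t}\sqrt{F_1(t_1)F_2(t_2)}$; $I(F,c)=\int_{\mathbb R^n}F(c^2\|x\|^2/2)dx$; $\frac{\|\cdot\|^2}{2}$ denotes $x\mapsto\|x\|^2/2$. For $z\in\mathbb R^n$, $\psi_z(x)=\psi(x+z)$; the functional Blaschke–Santaló inequality (Fradelizi–Meyer, Lehec) provides $z_0$ with $I(F_1\circ\psi,\psi)I(F_2\circ\psi_{z_0}^*,\psi_{z_0}^* )\le[I(\breve F,1)]^2$; $\mathcal C_0$ is the set of $\psi\in\mathcal C$ with $z_0=0$, so that $I(F_1\circ\psi,\psi)I(F_2\circ\psi^*,\psi^* )\le[I(\breve F,1)]^2$, with equality (for $\breve F$ strictly decreasing, nonzero integrals) iff (E). Condition (E): there exist $b>0$, $a\in\mathbb R$ and positive definite $A$ with $\psi(x)=\langle Ax,x\rangle+a$, $F_1(t+a)=b\breve F(t)$, $bF_2(t-a)=\breve F(t)$ for all $x\in\mathbb R^n$, $t\ge0$. *)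

(* Defs.v *)
From HB Require Import structures.
From mathcomp Require Import all_boot all_order all_algebra.
From mathcomp Require Import all_classical all_reals all_analysis.
Set Implicit Arguments. Unset Strict Implicit. Unset Printing Implicit Defensive.
Import Order.TTheory GRing.Theory Num.Theory.
Import numFieldNormedType.Exports.
Local Open Scope classical_set_scope.
Local Open Scope ring_scope.

Section Defs.
Context {R : realType}.

Definition dotv {n} (x y : 'rV[R]_n) : R := \sum_(i < n) x ord0 i * y ord0 i.
Definition sqn {n} (x : 'rV[R]_n) : R := dotv x x.

(* ---------- Lebesgue integral on R^n ----------
   MathComp-Analysis has no n-dimensional Lebesgue measure; we use the
   iterated Lebesgue integral over R (equal to the integral w.r.t. the
   n-dimensional Lebesgue measure for nonnegative measurable integrands by
   Tonelli).  iint f = \int_R ... \int_R f(t_1,...,t_n) dt_n ... dt_1. *)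
Fixpoint iint (n : nat) : ('rV[R]_n -> \bar R) -> \bar R :=
  match n with
  | 0 => fun f => f 0
  | m.+1 => fun f =>
      (\int[@lebesgue_measure R]_(t in setT)
         iint (fun v : 'rV[R]_m => f (row_mx (\row_(j < 1) t) v)))%E
  end.

Definition intR {n} (A : set 'rV[R]_n) (f : 'rV[R]_n -> R) : \bar R :=
  iint (fun x => if `[< A x >] then (f x)%:E else 0%E).

Definition convex_fun {n} (psi : 'rV[R]_n -> \bar R) : Prop :=
  (forall x, psi x != -oo%E) /\
  forall x y : 'rV[R]_n, forall t : R, 0 < t < 1 ->
    (psi ((1 - t) *: x + t *: y)%R <= (1 - t)%:E * psi x + t%:E * psi y)%E.

Definition dom_int_nonempty {n} (psi : 'rV[R]_n -> \bar R) : Prop :=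
  exists (x0 : 'rV[R]_n) (r : R), 0 < r /\
    forall y, sqn (y - x0) < r ^+ 2 -> (psi y < +oo)%E.

Definition classC {n} (psi : 'rV[R]_n -> \bar R) : Prop :=
  convex_fun psi /\ dom_int_nonempty psi.

Definition legendre {n} (psi : 'rV[R]_n -> \bar R) : 'rV[R]_n -> \bar R :=
  fun y => ereal_sup [set ((dotv x y)%:E - psi x)%E | x in [set: 'rV[R]_n]].

Definition alex_at {n} (psi : 'rV[R]_n -> \bar R) (x v : 'rV[R]_n)
    (A : 'M[R]_n) : Prop :=
  A^T = A /\
  exists r : R, psi x = r%:E /\
    forall eps : R, 0 < eps -> exists delta : R, 0 < delta /\
      forall y, sqn (y - x) < delta ^+ 2 ->
        exists s : R, psi y = s%:E /\
          `| s - r - dotv v (y - x) - 2^-1 * dotv ((y - x) *m A) (y - x) |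
            <= eps * sqn (y - x).

Definition has_alex {n} (psi : 'rV[R]_n -> \bar R) (x : 'rV[R]_n) : Prop :=
  exists v A, alex_at psi x v A.

(* the (unique, when it exists) pair (gradient, Alexandrov Hessian) *)
Definition alex_data {n} (psi : 'rV[R]_n -> \bar R) (x : 'rV[R]_n)
    : 'rV[R]_n * 'M[R]_n :=
  xget (0, 0) [set p | alex_at psi x p.1 p.2].

Definition grad {n} (psi : 'rV[R]_n -> \bar R) x := (alex_data psi x).1.
Definition hess {n} (psi : 'rV[R]_n -> \bar R) x := (alex_data psi x).2.

Definition Xset {n} (psi : 'rV[R]_n -> \bar R) : set 'rV[R]_n :=
  [set x | (psi x < +oo)%E /\ has_alex psi x /\ hess psi x \in unitmx].

Definition I_on {n} (psi : 'rV[R]_n -> \bar R) (h : 'rV[R]_n -> R) : \bar R :=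
  intR (Xset psi) h.

(* F o psi, with the convention (F o psi)(x) = 0 where psi(x) = +oo *)
Definition Fcomp {n} (F : R -> R) (psi : 'rV[R]_n -> \bar R) : 'rV[R]_n -> R :=
  fun x => match psi x with r%:E => F r | _ => 0 end.

Definition Iball (n : nat) (F : R -> R) (c : R) : \bar R :=
  intR [set: 'rV[R]_n] (fun x => F (c ^+ 2 * sqn x / 2)).

Definition log_concave {n} (g : 'rV[R]_n -> R) : Prop :=
  (forall x, 0 <= g x) /\
  forall x y (t : R), 0 < t < 1 ->
    g x `^ (1 - t) * g y `^ t <= g ((1 - t) *: x + t *: y).

Definition Lclass {n} (psi : 'rV[R]_n -> \bar R) (g : 'rV[R]_n -> R) : Prop :=
  log_concave g /\ (forall y, Xset (legendre psi) y -> 0 < g y) /\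
  (0 < I_on (legendre psi) g < +oo)%E.

Definition Vfun {n} (p : R) (F1 F2 : R -> R) (psi : 'rV[R]_n -> \bar R)
    (g : 'rV[R]_n -> R) : \bar R :=
  intR (Xset psi) (fun x =>
    (F2 (dotv x (grad psi x) - fine (psi x)) / g (grad psi x)) `^ (p / n%:R)
    * F1 (fine (psi x))).

Definition Gfun {n} (p : R) (F1 F2 : R -> R) (psi : 'rV[R]_n -> \bar R)
    : \bar R :=
  let S := [set (Vfun p F1 F2 psi g `^ (n%:R / (n%:R + p))
                 * I_on (legendre psi) g `^ (p / (n%:R + p)))%E
           | g in Lclass psi] in
  if 0 <= p then ereal_inf S else ereal_sup S.

Definition Fbreve (F1 F2 : R -> R) (t : R) : R :=
  fine (ereal_sup [set (Num.sqrt (F1 q.1 * F2 q.2))%:E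
                  | q in [set q : R * R | t <= (q.1 + q.2) / 2]]).

Definition strictly_decreasing (F : R -> R) : Prop :=
  forall s t, s < t -> F t < F s.

Definition halfsq {n} : 'rV[R]_n -> \bar R := fun x => (sqn x / 2)%:E.

Definition condE {n} (psi : 'rV[R]_n -> \bar R) (F1 F2 : R -> R) : Prop :=
  exists (b a : R) (A : 'M[R]_n),
    0 < b /\ A^T = A /\ (forall x, x != 0 -> 0 < dotv (x *m A) x) /\
    (forall x, psi x = (dotv (x *m A) x + a)%:E) /\
    (forall t, 0 <= t ->
       F1 (t + a) = b * Fbreve F1 F2 t /\ b * F2 (t - a) = Fbreve F1 F2 t).

(* the class C_0 (depending on F1, F2): psi in C for which the functional
   Blaschke--Santalo inequality holds with z0 = 0, together with its
   equality case, as stated in the context. *)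
Definition classC0 {n} (F1 F2 : R -> R) (psi : 'rV[R]_n -> \bar R) : Prop :=
  classC psi /\
  (I_on psi (Fcomp F1 psi) * I_on (legendre psi) (Fcomp F2 (legendre psi))
     <= Iball n (Fbreve F1 F2) 1 * Iball n (Fbreve F1 F2) 1)%E /\
  (strictly_decreasing (Fbreve F1 F2) ->
   I_on psi (Fcomp F1 psi) != 0%E ->
   I_on (legendre psi) (Fcomp F2 (legendre psi)) != 0%E ->
   ((I_on psi (Fcomp F1 psi) * I_on (legendre psi) (Fcomp F2 (legendre psi))
      = Iball n (Fbreve F1 F2) 1 * Iball n (Fbreve F1 F2) 1)%E
    <-> condE psi F1 F2)).

End Defs.

(* Main.v *)
(** Let [phi] be the convex conjugate of [psi], [a = n/(n+p)], [b = p/(n+p)],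
    and let [I1], [I2] be the integrals of [F1 o psi] and [F2 o phi].  Since
    [phi(grad psi) = <x, grad psi> - psi], the test function [g = F2 o phi]
    gives [G(psi) <= I1^a I2^b]; dually [g = F1 o psi] gives
    [G(phi) <= I2^a I1^b], so the product is at most [I1 I2], which the
    Blaschke-Santalo inequality bounds by [I(Fbreve,1)^2].  As [psi] need not be
    lower semicontinuous, the dual bound uses that [psi] agrees with its
    biconjugate on the interior of its domain, and that [grad phi] maps the
    points where the Hessian of [phi] is invertible into that interior.  When
    [psi] is a positive definite quadratic, [grad psi] is linear, and Hoelder's
    inequality together with a linear change of variables turns the upper bound
    into an equality; this evaluates [G(|x|^2/2) = I(Fbreve,1)] and settles the
    equality case. *)

Require Import Defs.
From HB Require Import structures.
From mathcomp Require Import all_boot all_order all_algebra.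
From mathcomp Require Import ring lra.
From mathcomp Require Import all_classical all_reals all_analysis.
From mathcomp Require Import measurable_realfun.
Import Order.TTheory GRing.Theory Num.Theory.
Import numFieldNormedType.Exports.
Local Open Scope classical_set_scope.
Local Open Scope ring_scope.
Set Implicit Arguments.
Unset Strict Implicit.

(** * Iterated integrals *)

Section IteratedIntegral.
Context {R : realType}.
Local Notation mu := (@lebesgue_measure R).

Definition rv_measurable_family d (T : measurableType d) n
    (F : T -> 'rV[R]_n -> \bar R) : Prop :=
  forall d' (T' : measurableType d') (a : T' -> T) (u : 'I_n -> T' -> R),
    measurable_fun setT a -> (forall i, measurable_fun setT (u i)) ->
    measurable_fun setT (fun w => F (a w) (\row_i u i w)).

Definition rv_measurable n (f : 'rV[R]_n -> \bar R) : Prop :=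
  forall d (T : measurableType d) (u : 'I_n -> T -> R),
    (forall i, measurable_fun setT (u i)) ->
    measurable_fun setT (fun w => f (\row_i u i w)).

Lemma row_mx_row_split T m (a : T -> R) (u : 'I_m -> T -> R) (w : T) :
  row_mx (\row_(j < 1) a w) (\row_i u i w) =
  \row_(j < 1 + m) (match fintype.split j with inl _ => a | inr k => u k end) w.
Proof. by apply/rowP => j; rewrite !mxE; case: fintype.splitP => k _; rewrite mxE. Qed.

Lemma iint_ge0 n (f : 'rV[R]_n -> \bar R) :
  (forall x, 0 <= f x)%E -> (0 <= iint f)%E.
Proof.
elim: n f => [|m IH] f f0 //=.
by apply: integral_ge0 => t _; exact: IH.
Qed.

Lemma measurable_iint d (T : measurableType d) n (F : T -> 'rV[R]_n -> \bar R) :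
  (forall w x, 0 <= F w x)%E -> rv_measurable_family F ->
  measurable_fun setT (fun w => iint (F w)).
Proof.
elim: n d T F => [|m IH] d T F F0 mF /=.
  have := mF _ _ id (fun=> cst 0) (@measurable_id _ _ _) (fun=> measurable_cst _).
  by congr (measurable_fun _ _); apply/funext => w /=; congr (F _ _); apply/rowP => -[].
pose F' (z : T * measurableTypeR R) (v : 'rV[R]_m) :=
  F z.1 (row_mx (\row_(j < 1) z.2) v).
have mF' : measurable_fun setT (fun z => iint (F' z)).
  apply: IH => [w x|d' T' a u ma mu']; rewrite /F'; first exact: F0.
  rewrite (_ : (fun w => _) = fun w => F (a w).1 (\row_(j < 1 + m)
      (match fintype.split j with inl _ => fun w => (a w).2 | inr k => u k end) w));
    last by apply/funext => w; rewrite -row_mx_row_split.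
  apply: mF; first exact: measurableT_comp.
  by move=> i; case: fintype.split => [_|//]; exact: measurableT_comp.
apply: (measurable_fun_fubini_tonelli_F (m2 := mu) _ mF') => z.
by apply: iint_ge0 => x; exact: F0.
Qed.

Lemma rv_measurable_familyS n (f : 'rV[R]_n.+1 -> \bar R) :
  rv_measurable f ->
  rv_measurable_family
    (fun (t : measurableTypeR R) v => f (row_mx (\row_(j < 1) t) v)).
Proof.
move=> mf d T a u ma mu'.
rewrite (_ : (fun w => _) = fun w => f (\row_(j < 1 + n)
    (match fintype.split j with inl _ => a | inr k => u k end) w));
  last by apply/funext => w; rewrite -row_mx_row_split.
by apply: mf => i; case: fintype.split.
Qed.

Lemma rv_measurable_section n d (T : measurableType d)
    (F : T -> 'rV[R]_n -> \bar R) t :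
  rv_measurable_family F -> rv_measurable (F t).
Proof. by move=> mF d' T' u mu'; apply: (mF _ _ (cst t)). Qed.

Lemma measurable_iintS n (f : 'rV[R]_n.+1 -> \bar R) :
  (forall x, 0 <= f x)%E -> rv_measurable f ->
  measurable_fun setT (fun t => iint (fun v => f (row_mx (\row_(j < 1) t) v))).
Proof.
move=> f0 mf; apply: (measurable_iint
  (F := fun (t : measurableTypeR R) v => f (row_mx (\row_(j < 1) t) v))) => //.
exact: rv_measurable_familyS.
Qed.

Lemma iint_le n (f g : 'rV[R]_n -> \bar R) :
  (forall x, 0 <= f x)%E -> (forall x, f x <= g x)%E ->
  rv_measurable f -> rv_measurable g -> (iint f <= iint g)%E.
Proof.
elim: n f g => [|m IH] f g f0 fg mf mg //=.
have g0 x : (0 <= g x)%E by exact: le_trans (fg x).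
apply: ge0_le_integral => //.
- by move=> t _; exact: iint_ge0.
- exact: measurable_iintS.
- exact: measurable_iintS.
- move=> t _; apply: IH => //.
  + exact: rv_measurable_section (rv_measurable_familyS mf).
  + exact: rv_measurable_section (rv_measurable_familyS mg).
Qed.

Lemma iintD n (f g : 'rV[R]_n -> \bar R) :
  (forall x, 0 <= f x)%E -> (forall x, 0 <= g x)%E ->
  rv_measurable f -> rv_measurable g ->
  iint (fun x => f x + g x)%E = (iint f + iint g)%E.
Proof.
elim: n f g => [|m IH] f g f0 g0 mf mg //=.
rewrite -ge0_integralD//.
- apply: eq_integral => t _; apply: IH => //.
  + exact: rv_measurable_section (rv_measurable_familyS mf).
  + exact: rv_measurable_section (rv_measurable_familyS mg).
- by move=> t _; exact: iint_ge0.
- exact: measurable_iintS.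
- by move=> t _; exact: iint_ge0.
- exact: measurable_iintS.
Qed.

Lemma iintZl n (k : R) (f : 'rV[R]_n -> \bar R) :
  0 <= k -> (forall x, 0 <= f x)%E -> rv_measurable f ->
  iint (fun x => k%:E * f x)%E = (k%:E * iint f)%E.
Proof.
move=> k0; elim: n f => [|m IH] f f0 mf //=.
rewrite -ge0_integralZl//.
- apply: eq_integral => t _; apply: IH => //.
  exact: rv_measurable_section (rv_measurable_familyS mf).
- exact: measurable_iintS.
- by move=> t _; exact: iint_ge0.
Qed.

Lemma integral_iintC n (F : R -> 'rV[R]_n -> \bar R) :
  (forall t x, 0 <= F t x)%E -> rv_measurable_family (F : measurableTypeR R -> _) ->
  (\int[mu]_t iint (F t) = iint (fun v => \int[mu]_t F t v))%E.
Proof.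
elim: n F => [|m IH] F F0 mF //=.
pose G (z : measurableTypeR R * measurableTypeR R) (v : 'rV[R]_m) :=
  F z.1 (row_mx (\row_(j < 1) z.2) v).
have mG : rv_measurable_family G.
  move=> d T a u ma mu'; rewrite /G.
  rewrite (_ : (fun w => _) = fun w => F (a w).1 (\row_(j < 1 + m)
      (match fintype.split j with inl _ => fun w => (a w).2 | inr k => u k end) w));
    last by apply/funext => w; rewrite -row_mx_row_split.
  apply: mF; first exact: measurableT_comp.
  by move=> i; case: fintype.split => [_|//]; exact: measurableT_comp.
have G0 z v : (0 <= G z v)%E by exact: F0.
have mGi := measurable_iint G0 mG.
rewrite (fubini_tonelli (m1 := mu) (m2 := mu) _ mGi) => [|z]; last exact: iint_ge0.
apply: eq_integral => s _.
rewrite -IH//.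
move=> d T a u ma mu'.
by apply: (mG _ _ (fun w => (a w, s)) u) => //; exact: measurable_fun_pair.
Qed.

Lemma integral_affine (f : R -> \bar R) (k c : R) : 0 < k ->
  measurable_fun setT f -> (forall t, 0 <= f t)%E ->
  (\int[mu]_t f (k * t + c)%R = (k^-1)%:E * \int[mu]_t f t)%E.
Proof.
move=> k0 mf f0.
pose phi : measurableTypeR R -> measurableTypeR R := fun t => k * t + c.
have mphi : measurable_fun setT phi.
  by apply: measurable_funD => //; exact: measurable_funM.
have ki0 : 0 <= k^-1 by rewrite invr_ge0 ltW.
have phimu A : measurable A -> mscale (NngNum ki0) mu A = pushforward mu phi A.
  move=> mA.
  have kmu B : measurable B -> mu B = mscale (NngNum (ltW k0)) (pushforward mu phi) B.
    move=> mB; apply: lebesgue_measure_unique => //= _ [[a b]] _ <-.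
    rewrite /mscale/= /pushforward (_ : phi @^-1` _ = `](a - c) / k, (b - c) / k]%classic); last first.
      apply/seteqP; split => t /=; rewrite !in_itv/= /phi ltr_pdivrMr// ler_pdivlMr//;
        rewrite ltrBlDr lerBrDr mulrC//.
    rewrite !lebesgue_measure_itv/= !lte_fin ltr_pM2r ?invr_gt0// ltrD2r.
    case: ifP => _; last by rewrite mule0.
    by rewrite -!EFinB -EFinM; congr EFin; field; rewrite gt_eqF.
  rewrite /mscale/= kmu// /mscale/= muleA -EFinM mulVf ?gt_eqF// mul1e//.
transitivity (\int[pushforward mu phi]_t f t)%E.
  by rewrite ge0_integral_pushforward.
rewrite -(@ge0_integral_mscale _ _ _ mu setT measurableT (NngNum ki0))//.
by apply: eq_measure_integral => A mA _; exact/esym/phimu.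
Qed.

Lemma rv_measurable_integral n (F : R -> 'rV[R]_n -> \bar R) :
  (forall t x, 0 <= F t x)%E ->
  rv_measurable_family (F : measurableTypeR R -> _) ->
  rv_measurable (fun v => \int[mu]_t F t v)%E.
Proof.
move=> F0 mF d T u mu'.
apply: (measurable_fun_fubini_tonelli_F (m2 := mu)
  (fun z : T * measurableTypeR R => F z.2 (\row_i u i z.1))) => //.
apply: (mF _ _ snd (fun i z => u i z.1)) => //.
by move=> i; exact: measurableT_comp.
Qed.

Lemma rv_measurable_affine n m (f : 'rV[R]_m -> \bar R) (M : 'M[R]_(n, m)) c :
  rv_measurable f -> rv_measurable (fun x => f (x *m M + c)).
Proof.
move=> mf d T u mu'.
rewrite (_ : (fun w => _) =
    fun w => f (\row_j ((\sum_i u i w * M i j) + c ord0 j))); last first.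
  apply/funext => w; congr f; apply/rowP => j; rewrite !mxE; congr (_ + _).
  by apply: eq_bigr => i _; rewrite mxE.
apply: (mf _ _ (fun j w => (\sum_i u i w * M i j) + c ord0 j)) => j.
apply: measurable_funD => //; apply: measurable_sum => i.
exact: measurable_funM.
Qed.

Lemma addr_row_mx m t (v : 'rV[R]_m) (c : 'rV[R]_(1 + m)) :
  row_mx (\row_(j < 1) t) v + c =
  row_mx (\row_(j < 1) (1 * t + c ord0 (lshift m ord0))) (v + rsubmx c).
Proof.
rewrite -{1}[c]hsubmxK add_row_mx; congr row_mx.
by apply/rowP => j; rewrite ord1 !mxE mul1r.
Qed.

Lemma iint_shift n (f : 'rV[R]_n -> \bar R) (c : 'rV[R]_n) :
  (forall x, 0 <= f x)%E -> rv_measurable f ->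
  iint (fun x => f (x + c)) = iint f.
Proof.
elim: n f c => [|m IH] f c f0 mf /=; first by rewrite [0 + c]thinmx0.
transitivity (\int[mu]_t iint (fun v =>
    f (row_mx (\row_(j < 1) (1 * t + (c : 'rV_(1 + m)) ord0 (lshift m ord0))%R) v)))%E.
  apply: eq_integral => t _.
  rewrite -[RHS](IH _ (rsubmx (c : 'rV_(1 + m))))//; last first.
    exact: rv_measurable_section (rv_measurable_familyS mf).
  congr iint; apply/funext => v; congr f.
  exact: addr_row_mx.
rewrite (integral_affine
  (f := fun t => iint (fun v => f (row_mx (\row_(j < 1) t) v))))//.
- by rewrite invr1 mul1e.
- exact: measurable_iintS.
- by move=> t; exact: iint_ge0.
Qed.

Lemma dotv_row_mx m1 m2 (a c : 'rV[R]_m1) (b e : 'rV[R]_m2) :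
  dotv (row_mx a b) (row_mx c e) = dotv a c + dotv b e.
Proof.
rewrite /dotv big_split_ord/=.
by congr (_ + _); apply: eq_bigr => i _; rewrite ?row_mxEl ?row_mxEr.
Qed.

Definition posdef n (A : 'M[R]_n) : Prop :=
  A^T = A /\ forall x, x != 0 -> 0 < dotv (x *m A) x.

Lemma iint_posdef n (A : 'M[R]_n) : posdef A -> exists2 k : R, 0 < k &
  forall f, (forall x, 0 <= f x)%E -> rv_measurable f ->
    iint (fun x => f (x *m A)) = (k%:E * iint f)%E.
Proof.
elim: n A => [|m IH] A.
  by exists 1 => // f _ _ /=; rewrite mul1e mul0mx.
move=> [symA posA].
pose A' : 'M[R]_(1 + m) := A.
have posA' (x : 'rV_(1 + m)) : x != 0 -> 0 < dotv (x *m A') x := posA x.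
pose d := A' ord0 ord0; pose w := ursubmx A'.
pose c (v : 'rV[R]_m) := (v *m dlsubmx A') ord0 ord0.
have mulA t v : row_mx (\row_(j < 1) t) v *m A' =
    row_mx (\row_(j < 1) (d * t + c v)) (t *: w + v *m drsubmx A').
  rewrite -{1}[A']submxK mul_row_block; congr row_mx.
    apply/rowP => j; rewrite ord1 !mxE big_ord1 !mxE mulrC /c !mxE; congr (_ * _ + _).
    by congr (A' _ _); apply/val_inj.
  by congr (_ + _); apply/rowP => j; rewrite !mxE big_ord1 !mxE.
have d_gt0 : 0 < d.
  have := posA' (row_mx (\row_(j < 1) 1) 0); rewrite mulA dotv_row_mx.
  rewrite /c !mul0mx mxE /dotv big_ord1 big1 => [|i _]; last by rewrite [X in _ * X]mxE mulr0.
  rewrite !mxE !mulr1 !addr0; apply; apply/eqP => /rowP/(_ (lshift m ord0)).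
  by rewrite row_mxEl !mxE => /eqP; rewrite oner_eq0.
have wE : dlsubmx A' = w^T by rewrite /w trmx_ursub [A'^T]symA.
pose S := drsubmx A' - d^-1 *: (dlsubmx A' *m w).
have shearE s v : ((s - c v) / d) *: w + v *m drsubmx A' = (s / d) *: w + v *m S.
  rewrite /S mulmxBr -scalemxAr mulmxA (_ : v *m dlsubmx A' = (c v)%:M); last first.
    by apply/rowP => j; rewrite ord1 [RHS]mxE eqxx mulr1n.
  by rewrite mul_scalar_mx scalerA mulrBl scalerBl -!addrA (mulrC d^-1) (addrC (- _)).
have pdS : posdef S.
  split.
    rewrite /S linearB/= linearZ/= trmx_mul wE trmxK -wE trmx_drsub.
    by rewrite [A'^T]symA.
  move=> v v0; have := posA' (row_mx (\row_(j < 1) ((0 - c v) / d)) v).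
  rewrite mulA shearE dotv_row_mx mul0r scale0r add0r.
  rewrite {1}/dotv big_ord1 !mxE (mulrC d) divfK ?gt_eqF// addNr mul0r !add0r.
  apply; apply: contra_neq v0 => v0; apply/rowP => j.
  by have /rowP/(_ (rshift 1 j)) := v0; rewrite row_mxEr !mxE.
have [k k0 kP] := IH _ pdS.
exists (d^-1 * k); first by rewrite mulr_gt0// invr_gt0.
move=> f f0 mf.
pose B : 'M[R]_(1 + m) := block_mx 1%:M (d^-1 *: w) 0 S.
pose G s v := f (row_mx (\row_(j < 1) s) ((s / d) *: w + v *m S)).
have mG : rv_measurable_family (G : measurableTypeR R -> _).
  have mfB : rv_measurable (fun x => f (x *m B)).
    have := rv_measurable_affine B 0 mf.
    by under eq_fun do rewrite addr0.
  have := rv_measurable_familyS mfB; congr rv_measurable_family.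
  apply/funext => s; apply/funext => v; rewrite /G/B; congr f.
  rewrite mul_row_block mulmx1 mulmx0 addr0.
  rewrite (_ : _ *m (_ *: w) = (s / d) *: w)//.
  by apply/rowP => j; rewrite !mxE big_ord1 !mxE mulrA.
have G0 s v : (0 <= G s v)%E by exact: f0.
have mfA : rv_measurable (fun x => f (x *m A)).
  have := rv_measurable_affine A 0 mf.
  by under eq_fun do rewrite addr0.
rewrite /= integral_iintC//; last exact: rv_measurable_familyS mfA.
transitivity (iint (fun v => (d^-1)%:E * \int[mu]_s G s v)%E).
  congr iint; apply/funext => v.
  rewrite -(integral_affine (f := G ^~ v) (c v))//.
    apply: eq_integral => t _; rewrite /G -shearE addrK.
    by rewrite [_ *m _]mulA (mulrC d) mulfK ?gt_eqF.
  have := mG _ _ (@id (measurableTypeR R)) (fun i => cst (v ord0 i))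
    (@measurable_id _ _ _) (fun i => measurable_cst _).
  congr measurable_fun; apply/funext => s; congr (G _ _).
  by apply/rowP => j; rewrite mxE.
rewrite iintZl ?invr_ge0 ?ltW//; last 2 first.
- by move=> v; apply: integral_ge0.
- exact: rv_measurable_integral.
rewrite -integral_iintC// EFinM -muleA; congr (_ * _)%E.
rewrite -ge0_integralZl//; last 3 first.
- exact: measurable_iintS.
- by move=> t _; exact: iint_ge0.
- by rewrite lee_fin ltW.
apply: eq_integral => s _.
have ms := rv_measurable_section s (rv_measurable_familyS mf).
rewrite -(iint_shift ((s / d) *: w) _ ms)// -kP//.
  by congr iint; apply/funext => v; rewrite /G addrC.
have := rv_measurable_affine 1%:M ((s / d) *: w) ms.
by under eq_fun do rewrite mulmx1.
Qed.

End IteratedIntegral.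

(** * Log-concave functions and Hoelder's inequality *)

Section LogConcave.
Context {R : realType}.

Definition lsc_box n (g : 'rV[R]_n -> R) : Prop :=
  forall x a, a < g x -> exists2 e, 0 < e &
    forall y : 'rV[R]_n, (forall i, `|y ord0 i - x ord0 i| < e) -> a < g y.

Lemma lsc_box_measurable n (g : 'rV[R]_n -> R) :
  lsc_box g -> rv_measurable (fun x => (g x)%:E).
Proof.
move=> lg d T u mu; apply/measurable_EFinP.
apply: (measurability _ (RGenOInfty.measurableE R)) => _ [_ [a ->] <-].
pose box (q : 'rV[rat]_n * rat) (y : 'rV[R]_n) :=
  forall i, `|y ord0 i - ratr (q.1 ord0 i)| < ratr q.2.
pose U (q : 'rV[rat]_n * rat) := \bigcap_(i in [set: 'I_n])
  (u i @^-1` `]ratr (q.1 ord0 i) - ratr q.2, ratr (q.1 ord0 i) + ratr q.2[).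
pose U' (q : 'rV[rat]_n * rat) :=
  [set w : T | forall y, box q y -> a < g y] `&` U q.
rewrite setTI (_ : _ @^-1` _ = \bigcup_q U' q); last first.
  apply/seteqP; split => [w /=|w [q _ [/= qg Uw]]]; last first.
    rewrite in_itv/= andbT; apply: qg => i; rewrite mxE.
    by have := Uw i I; rewrite /= in_itv/= ltr_distl.
  rewrite in_itv/= andbT => /lg[e e0 eg].
  have [r] : exists r : rat, ratr r \in `]0, e / 2[%R.
    by apply: rat_in_itvoo; rewrite divr_gt0.
  rewrite in_itv/= => /andP[r0 re].
  have /choice[q qP] : forall i, exists q : rat,
      ratr q \in `]u i w - ratr r, u i w + ratr r[%R.
    by move=> i; apply: rat_in_itvoo; lra.
  exists (\row_i q i, r) => //; split => [y /= yq|i _ /=]; last first.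
    by have := qP i; rewrite !in_itv/= !mxE => /andP[]; lra.
  apply: eg => i; have := yq i; have := qP i.
  by rewrite /= in_itv/= !mxE !ltr_distl => /andP[h1 h2] /andP[h3 h4]; lra.
apply: countable_bigcupT_measurable => [|q]; first exact: countableP.
have [qg|nqg] := pselect (forall y, box q y -> a < g y); last first.
  by rewrite (_ : U' q = set0) //; apply/seteqP; split => // w [].
rewrite (_ : U' q = U q); last by apply/seteqP; split => // w [].
apply: fin_bigcap_measurable => // i _.
by rewrite -[X in measurable X]setTI; exact: mu.
Qed.

Definition concave_rv n (f : 'rV[R]_n -> R) : Prop :=
  forall x y (t : R), 0 < t < 1 ->
    (1 - t) * f x + t * f y <= f ((1 - t) *: x + t *: y).

Lemma concave_mean_gt n (f : 'rV[R]_n -> R) (b : R) (s : seq 'rV[R]_n) :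
  concave_rv f -> s != [::] -> (forall p, p \in s -> b < f p) ->
  b < f ((size s)%:R^-1 *: \sum_(p <- s) p).
Proof.
move=> cf; elim: s => [//|p [|q s] IH] _ sP.
  by rewrite big_seq1 invr1 scale1r; apply: sP; rewrite mem_head.
have fs : b < f ((size (q :: s))%:R^-1 *: \sum_(p <- q :: s) p).
  by apply: IH => // z zs; apply: sP; rewrite in_cons zs orbT.
have fp : b < f p by apply: sP; rewrite mem_head.
set m := size (q :: s) in fs *; set z := \sum_(p <- q :: s) p in fs *.
have m0 : 0 < m%:R :> R by rewrite ltr0n.
have := cf (m%:R^-1 *: z) p (m.+1%:R^-1); rewrite big_cons -/z.
have -> : size [:: p, q & s] = m.+1 by [].
have m10 : m.+1%:R != 0 :> R by rewrite pnatr_eq0.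
have -> : (1 - m.+1%:R^-1) *: (m%:R^-1 *: z) = m.+1%:R^-1 *: z.
  by rewrite scalerA; congr (_ *: _); rewrite -natr1; field; rewrite natr1 m10 gt_eqF.
rewrite -scalerDr (addrC z).
have t0 : 0 < m.+1%:R^-1 :> R by rewrite invr_gt0 ltr0n.
have t1 : m.+1%:R^-1 < 1 :> R by rewrite invf_lt1 ?ltr0n// ltr1n.
rewrite t0 t1 => /(_ isT); apply: lt_le_trans.
set t := _^-1 in t0 t1 *.
have h1 : 0 < (1 - t) * (f (m%:R^-1 *: z) - b) by rewrite mulr_gt0 ?subr_gt0.
have h2 : 0 < t * (f p - b) by rewrite mulr_gt0 ?subr_gt0.
nra.
Qed.

Lemma concave_ray_gt n (f : 'rV[R]_n -> R) (b : R) x v :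
  concave_rv f -> b < f x ->
  exists2 e, 0 < e & forall s, 0 <= s < e -> b < f (x + s *: v).
Proof.
move=> cf bfx; set D := f x - f (x + v).
have D1 : 0 < `|D| + 1 by rewrite ltr_pwDr.
exists (Num.min 1 ((f x - b) / (`|D| + 1))).
  by rewrite lt_min ltr01 divr_gt0 ?subr_gt0.
move=> s /andP[]; rewrite le_eqVlt => /predU1P[<-|s0].
  by rewrite scale0r addr0.
rewrite lt_min => /andP[s1]; rewrite ltr_pdivlMr// => sD.
have := cf x (x + v) s; rewrite s0 s1 => /(_ isT).
have -> : (1 - s) *: x + s *: (x + v) = x + s *: v.
  by rewrite scalerDr scalerBl scale1r addrA subrK.
apply: lt_le_trans.
have : s * D <= s * `|D| by rewrite ler_pM2l// ler_norm.
rewrite {1}/D; nra.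
Qed.

Lemma concave_lsc_box n (f : 'rV[R]_n -> R) : concave_rv f -> lsc_box f.
Proof.
move=> cf x b bfx.
case: n f cf x bfx => [|n] f cf x bfx.
  by exists 1 => // y _; have -> : y = x by rewrite [y]thinmx0 [x]thinmx0.
have /choice[e eP] : forall i : 'I_n.+1, exists e, 0 < e /\
    forall s, `|s| < e -> b < f (x + s *: delta_mx ord0 i).
  move=> i.
  have [e1 e10 e1P] := concave_ray_gt (delta_mx ord0 i) cf bfx.
  have [e2 e20 e2P] := concave_ray_gt (- delta_mx ord0 i) cf bfx.
  exists (Num.min e1 e2); split; first by rewrite lt_min e10.
  move=> s; rewrite lt_min => /andP[se1 se2].
  have [s0|s0] := leP 0 s; first by apply: e1P; rewrite s0 -(ger0_norm s0).
  have -> : s *: delta_mx ord0 i = (- s) *: (- delta_mx ord0 i) :> 'rV[R]_n.+1.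
    by rewrite scalerN scaleNr opprK.
  by apply: e2P; rewrite -(ltr0_norm s0) normr_ge0.
pose E := 1 + \sum_i (e i)^-1.
have sum0 (P : pred 'I_n.+1) : 0 <= \sum_(i | P i) (e i)^-1.
  by apply: sumr_ge0 => i _; rewrite invr_ge0 ltW// (eP i).1.
have E0 : 0 < E by rewrite ltr_pwDl.
have Ee i : E^-1 <= e i.
  rewrite -[e i]invrK lef_pV2 ?posrE ?invr_gt0 ?(eP i).1//.
  by rewrite /E (bigD1 i)//= addrCA lerDl addr_ge0.
have n0 : 0 < n.+1%:R :> R by rewrite ltr0n.
exists (E^-1 / n.+1%:R); first by rewrite divr_gt0 ?invr_gt0.
move=> y yx.
pose P i : 'rV[R]_n.+1 := x + (n.+1%:R * (y ord0 i - x ord0 i)) *: delta_mx ord0 i.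
have := @concave_mean_gt _ f b [seq P i | i <- enum 'I_n.+1] cf.
rewrite size_map size_enum_ord big_map big_enum/= => H.
have -> : y = n.+1%:R^-1 *: \sum_i P i.
  rewrite /P big_split/= sumr_const card_ord -(scaler_nat _ x) scalerDr scalerA.
  rewrite mulVf ?gt_eqF// scale1r scaler_sumr.
  have -> : \sum_i n.+1%:R^-1 *: ((n.+1%:R * (y ord0 i - x ord0 i)) *: delta_mx ord0 i)
      = \sum_i (y - x) ord0 i *: delta_mx ord0 i :> 'rV[R]_n.+1.
    by apply: eq_bigr => i _; rewrite scalerA mulKf ?gt_eqF// !mxE.
  by rewrite -row_sum_delta addrC subrK.
apply: H; first by rewrite -size_eq0 size_map size_enum_ord.
move=> _ /mapP[i _ ->]; apply: (eP i).2; apply: lt_le_trans (Ee i).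
by rewrite normrM gtr0_norm// mulrC -ltr_pdivlMr.
Qed.

Lemma log_concave_measurable n (g : 'rV[R]_n -> R) :
  log_concave g -> (forall x, 0 < g x) -> rv_measurable (fun x => (g x)%:E).
Proof.
move=> [_ lg] g0; apply: lsc_box_measurable.
have cg : concave_rv (fun x => ln (g x)).
  move=> x y t t01; rewrite -!ln_powR -lnM ?posrE ?powR_gt0//.
  by rewrite ler_ln ?posrE ?mulr_gt0 ?powR_gt0// lg.
move=> x a agx.
have [a0|a0] := leP a 0.
  by exists 1 => // y _; exact: le_lt_trans (g0 y).
have [|e e0 eP] := @concave_lsc_box _ _ cg x (ln a).
  by rewrite ltr_ln ?posrE.
by exists e => // y /eP; rewrite ltr_ln ?posrE.
Qed.

Lemma young_weighted (al be a b : R) : 0 < al -> 0 < be -> al + be = 1 ->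
  0 <= a -> 0 <= b -> a `^ al * b `^ be <= al * a + be * b.
Proof.
move=> al0 be0 ab1 a0 b0.
have := @conjugate_powR R (a `^ al) (b `^ be) al^-1 be^-1.
rewrite !powR_ge0 !invr_gt0 al0 be0 !invrK => /(_ isT isT isT isT ab1).
rewrite -!powRrM !divff ?gt_eqF// !powRr1//.
by rewrite (mulrC a) (mulrC b).
Qed.

Lemma iint_young n (al be : R) (f g h : 'rV[R]_n -> R) (k l : R) :
  0 < al -> 0 < be -> al + be = 1 -> 0 < k -> 0 < l -> k `^ al * l `^ be = 1 ->
  (forall x, 0 <= f x) -> (forall x, 0 <= g x) ->
  (forall x, h x = f x `^ al * g x `^ be) ->
  rv_measurable (fun x => (f x)%:E) -> rv_measurable (fun x => (g x)%:E) ->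
  rv_measurable (fun x => (h x)%:E) ->
  (iint (fun x => (h x)%:E) <=
   (al * k)%:E * iint (fun x => (f x)%:E) + (be * l)%:E * iint (fun x => (g x)%:E))%E.
Proof.
move=> al0 be0 ab1 k0 l0 kl f0 g0 hE mf mg mh.
have ak : 0 <= al * k by rewrite mulr_ge0 ?ltW.
have bl : 0 <= be * l by rewrite mulr_ge0 ?ltW.
have fk x : (0 <= (al * k)%:E * (f x)%:E)%E by rewrite -EFinM lee_fin mulr_ge0.
have gl x : (0 <= (be * l)%:E * (g x)%:E)%E by rewrite -EFinM lee_fin mulr_ge0.
have mfk : rv_measurable (fun x => (al * k)%:E * (f x)%:E)%E.
  by move=> d T u mu; apply: measurable_funeM; exact: mf.
have mgl : rv_measurable (fun x => (be * l)%:E * (g x)%:E)%E.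
  by move=> d T u mu; apply: measurable_funeM; exact: mg.
rewrite -!iintZl// -iintD//; apply: iint_le => //.
- by move=> x; rewrite lee_fin hE mulr_ge0 ?powR_ge0.
- move=> x; rewrite -!EFinM -EFinD lee_fin hE.
  have := young_weighted al0 be0 ab1 (mulr_ge0 (ltW k0) (f0 x)) (mulr_ge0 (ltW l0) (g0 x)).
  rewrite !powRM ?(ltW k0) ?(ltW l0)// mulrACA kl mul1r !mulrA; exact.
- by move=> d T u mu; apply: emeasurable_funD; [exact: mfk|exact: mgl].
Qed.

Lemma iint_hoelder n (al be : R) (f g h : 'rV[R]_n -> R) :
  0 < al -> 0 < be -> al + be = 1 ->
  (forall x, 0 <= f x) -> (forall x, 0 <= g x) ->
  (forall x, h x = f x `^ al * g x `^ be) ->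
  rv_measurable (fun x => (f x)%:E) -> rv_measurable (fun x => (g x)%:E) ->
  rv_measurable (fun x => (h x)%:E) ->
  (0 < iint (fun x => (g x)%:E) < +oo)%E ->
  (iint (fun x => (h x)%:E) <=
   iint (fun x => (f x)%:E) `^ al * iint (fun x => (g x)%:E) `^ be)%E.
Proof.
move=> al0 be0 ab1 f0 g0 hE mf mg mh /andP[I0 Ioo].
have V0 : (0 <= iint (fun x => (f x)%:E))%E by apply: iint_ge0 => x; rewrite lee_fin.
have Y k l k0 l0 kl :=
  @iint_young n al be f g h k l al0 be0 ab1 k0 l0 kl f0 g0 hE mf mg mh.
move: (iint (fun x => (g x)%:E)) I0 Ioo Y => [I||]// I0 _.
rewrite lte_fin in I0.
move: (iint (fun x => (f x)%:E)) V0 => [V||]// V0 Y; last first.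
  by rewrite poweRyr ?gt_eqF// gt0_mulye ?leey// poweR_gt0.
have Ib : 0 < I `^ be by rewrite powR_gt0.
rewrite !poweR_EFin -EFinM.
move: V0; rewrite lee_fin le_eqVlt => /predU1P[V0|V0]; last first.
  have Va : 0 < V `^ al by rewrite powR_gt0.
  have [c cE] : exists c, c = V `^ al * I `^ be by exists (V `^ al * I `^ be).
  rewrite -cE; have c0 : 0 < c by rewrite cE mulr_gt0.
  have := Y (c / V) (c / I) (divr_gt0 c0 V0) (divr_gt0 c0 I0).
  rewrite -!EFinM -EFinD !powRM ?invr_ge0 ?(ltW c0) ?(ltW V0) ?(ltW I0)//.
  rewrite -!powR_inv1 ?(ltW V0) ?(ltW I0)// -!powRrM !mulN1r !powRN.
  rewrite mulrACA -powRD ?ab1 ?oner_eq0// powRr1 ?(ltW c0)//.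
  rewrite -invfM -cE divff ?gt_eqF// => /(_ erefl).
  rewrite !powRr1 ?(ltW V0) ?(ltW I0)//.
  by rewrite -mulrA divfK ?gt_eqF// -mulrA divfK ?gt_eqF// -mulrDl ab1 mul1r.
rewrite -V0 powR0 ?gt_eqF// mul0r; apply/lee_addgt0Pr => e e0; rewrite add0e.
pose l := e / (be * I); have l0 : 0 < l by rewrite divr_gt0 ?mulr_gt0.
have := Y (l `^ (- be / al)) l (powR_gt0 _ l0) l0.
rewrite -powRrM divfK ?gt_eqF// powRN mulVf ?gt_eqF ?powR_gt0// => /(_ erefl).
rewrite -V0 mule0 add0e -EFinM /l.
by rewrite (_ : be * _ * I = e)//; field; rewrite !gt_eqF.
Qed.

End LogConcave.

(** * The dot product and the Hahn-Banach theorem *)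

Section DotProduct.
Context {R : realType} {n : nat}.
Implicit Types (x y z : 'rV[R]_n) (t : R).

Lemma dotvE x y : dotv x y = (x *m y^T) ord0 ord0.
Proof. by rewrite mxE; apply: eq_bigr => i _; rewrite mxE. Qed.

Lemma dotvC x y : dotv x y = dotv y x.
Proof. by apply: eq_bigr => i _; rewrite mulrC. Qed.

Lemma dotvDl x y z : dotv (x + y) z = dotv x z + dotv y z.
Proof. by rewrite -big_split; apply: eq_bigr => i _; rewrite mxE mulrDl. Qed.

Lemma dotvZl t x y : dotv (t *: x) y = t * dotv x y.
Proof. by rewrite mulr_sumr; apply: eq_bigr => i _; rewrite mxE mulrA. Qed.

Lemma dotvDr x y z : dotv z (x + y) = dotv z x + dotv z y.
Proof. by rewrite !(dotvC z) dotvDl. Qed.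

Lemma dotvZr t x y : dotv x (t *: y) = t * dotv x y.
Proof. by rewrite !(dotvC x) dotvZl. Qed.

Lemma dotvNl x y : dotv (- x) y = - dotv x y.
Proof. by rewrite -scaleN1r dotvZl mulN1r. Qed.

Lemma dotvNr x y : dotv x (- y) = - dotv x y.
Proof. by rewrite !(dotvC x) dotvNl. Qed.

Lemma dotv0l x : dotv 0 x = 0.
Proof. by rewrite -(scale0r 0) dotvZl mul0r. Qed.

Lemma dotv0r x : dotv x 0 = 0.
Proof. by rewrite dotvC dotv0l. Qed.

Definition dotv_lin := (dotvDl, dotvDr, dotvNl, dotvNr, dotvZl, dotvZr).

Lemma dotv_mulmxl x y (A : 'M[R]_n) : dotv (x *m A) y = dotv x (y *m A^T).
Proof. by rewrite !dotvE trmx_mul trmxK mulmxA. Qed.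

Lemma sqn_ge0 x : 0 <= sqn x.
Proof. by apply: sumr_ge0 => i _; rewrite -expr2 sqr_ge0. Qed.

Lemma sqn0 : sqn (0 : 'rV[R]_n) = 0.
Proof. exact: dotv0l. Qed.

Lemma sqnZ t x : sqn (t *: x) = t ^+ 2 * sqn x.
Proof. by rewrite /sqn dotvZl dotvZr mulrA expr2. Qed.

Lemma sqnN x : sqn (- x) = sqn x.
Proof. by rewrite /sqn dotvNl dotvNr opprK. Qed.

Lemma sqnD x y : sqn (x + y) = sqn x + dotv x y *+ 2 + sqn y.
Proof. by rewrite /sqn !dotv_lin (dotvC y x); ring. Qed.

Lemma dotv_le_sqn x y : dotv x y <= (sqn x + sqn y) / 2.
Proof.
have := sqn_ge0 (x - y); rewrite sqnD sqnN dotvNr; lra.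
Qed.

Lemma sqnD_le x y : sqn (x + y) <= 2 * sqn x + 2 * sqn y.
Proof. by rewrite sqnD; have := dotv_le_sqn x y; lra. Qed.

Lemma cauchy_schwarz x y : dotv x y ^+ 2 <= sqn x * sqn y.
Proof.
have [y0|y0] := eqVneq (sqn y) 0.
  have H t : 2 * t * dotv x y <= sqn x.
    by have := dotv_le_sqn x ((2 * t) *: y); rewrite dotvZr sqnZ y0; have := sqn_ge0 x; lra.
  have [->|d0] := eqVneq (dotv x y) 0; first by rewrite y0 mulr0 expr0n.
  have := H ((sqn x + 1) / dotv x y).
  by rewrite -mulrA divfK//; have := sqn_ge0 x; lra.
have yp : 0 < sqn y by rewrite lt_def y0 sqn_ge0.
have := sqn_ge0 (sqn y *: x - dotv x y *: y).
rewrite sqnD sqnN !sqnZ dotvNr dotvZl dotvZr => H.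
rewrite -(ler_pM2l yp); nra.
Qed.

Lemma sqn_small x (r : R) : 0 < r -> exists2 t, 0 < t < 1 &
  forall s, 0 <= s <= t -> sqn (s *: x) < r ^+ 2.
Proof.
move=> r0; have x0 := sqn_ge0 x.
exists (Num.min (1 / 2) (r / (sqn x + 1))).
  by rewrite lt_min divr_gt0 ?divr_gt0 ?ltr_wpDl//= gt_min; apply/orP; left; lra.
move=> s; rewrite le_min => /and3P[s0 s1]; rewrite ler_pdivlMr ?ltr_wpDl// => sr.
rewrite sqnZ; have [->|s0'] := eqVneq s 0; first by rewrite expr0n mul0r exprn_gt0.
have sp : 0 < s by rewrite lt_def s0'.
have : (s * (sqn x + 1)) ^+ 2 <= r ^+ 2.
  by rewrite ler_pXn2r// nnegrE ?mulr_ge0 ?addr_ge0// ltW.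
by apply: lt_le_trans; rewrite exprMn ltr_pM2l ?exprn_gt0//; nra.
Qed.

End DotProduct.

Section HahnBanach.
Context {R : realType} {n : nat}.
Implicit Types (p q : 'rV[R]_n -> R).

Definition sublinear p : Prop :=
  (forall x y, p (x + y) <= p x + p y) /\
  (forall (t : R) x, 0 < t -> p (t *: x) <= t * p x).

Lemma sublinearZ p (t : R) x : sublinear p -> 0 < t -> p (t *: x) = t * p x.
Proof.
move=> [_ pZ] t0; apply/eqP; rewrite eq_le pZ//=.
have := pZ t^-1 (t *: x); rewrite invr_gt0 scalerA mulVf ?gt_eqF// scale1r.
by move=> /(_ t0); rewrite ler_pdivlMl.
Qed.

Lemma sublinear0 p : sublinear p -> p 0 = 0.
Proof. by move=> sp; have := sublinearZ 0 sp (ltr0n _ 2); rewrite scaler0; lra. Qed.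

Lemma sublinearN p x : sublinear p -> 0 <= p x + p (- x).
Proof. by move=> sp; rewrite -(sublinear0 sp) -(subrr x) sp.1. Qed.

Lemma sublinear_step p (e : 'rV[R]_n) : sublinear p -> exists q,
  [/\ sublinear q, forall x, q x <= p x, q e = p e & q (- e) = - p e].
Proof.
move=> sp.
pose S x := [set p (x + s *: e) - s * p e | s in [set: R]].
pose q x := inf (S x).
have S0 x : S x !=set0 by exists (p (x + 0 *: e) - 0 * p e), 0.
have lbS x : has_lbound (S x).
  exists (- p (- x)) => _ [s _ <-].
  suff : s * p e <= p (x + s *: e) + p (- x) by lra.
  have [s0|s0|->] := ltgtP s 0.
  - have := sublinearZ e sp (_ : 0 < - s); rewrite oppr_gt0 => /(_ s0) E.
    have : 0 <= p (x + s *: e) + p (- x) + p ((- s) *: e).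
      rewrite -(sublinear0 sp); apply: le_trans (lerD (sp.1 _ _) (lexx _)).
      apply: le_trans (sp.1 _ _); rewrite (_ : _ + _ = 0)//.
      by rewrite scaleNr addrAC addrK subrr.
    by rewrite E; lra.
  - rewrite -(sublinearZ e sp s0); apply: le_trans (sp.1 _ _).
    by rewrite addrAC subrr add0r.
  - by rewrite mul0r scale0r addr0; exact: sublinearN.
have qle x s : q x <= p (x + s *: e) - s * p e.
  by apply: ge_inf => //; exists s.
have q_ge m x : (forall s, m <= p (x + s *: e) - s * p e) -> m <= q x.
  by move=> H; apply: lb_le_inf => // _ [s _ <-].
have sq : sublinear q.
  split => [x y|t x t0].
    rewrite -lerBlDr; apply: (q_ge) => s.
    suff : q (x + y) - (p (x + s *: e) - s * p e) <= q y by lra.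
    apply: (q_ge) => s'; have := qle (x + y) (s + s').
    have := sp.1 (x + s *: e) (y + s' *: e).
    by rewrite addrACA -scalerDl; lra.
  rewrite -ler_pdivrMl//; apply: (q_ge) => s; rewrite ler_pdivrMl//.
  apply: le_trans (qle _ (t * s)) _.
  by rewrite -scalerA -scalerDr sublinearZ//; lra.
have qp x : q x <= p x.
  by have := qle x 0; rewrite scale0r addr0 mul0r subr0.
have qN : q (- e) <= - p e.
  by have := qle (- e) 1; rewrite scale1r addNr sublinear0// mul1r sub0r.
by exists q; split => //; have := sublinearN e sq; have := qp e; lra.
Qed.

Lemma sublinear_linearize (s : seq 'rV[R]_n) p : sublinear p -> exists q,
  [/\ sublinear q, forall x, q x <= p x & forall e, e \in s -> q (- e) = - q e].
Proof.
elim: s p => [|e s IH] p sp; first by exists p; split.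
have [q1 [sq1 q1p q1e q1Ne]] := sublinear_step e sp.
have [q [sq qq1 qs]] := IH _ sq1.
exists q; split => // [x|f]; first exact: le_trans (q1p x).
rewrite in_cons => /predU1P[->|/qs//].
by have := sublinearN e sq; have := qq1 e; have := qq1 (- e); lra.
Qed.

Lemma hahn_banach_rv p (h0 : 'rV[R]_n) : sublinear p ->
  exists2 u, forall h, dotv u h <= p h & dotv u h0 = p h0.
Proof.
move=> sp.
have [q0 [sq0 q0p q0h q0Nh]] := sublinear_step h0 sp.
have [q [sq qq0 qb]] := sublinear_linearize [seq delta_mx 0 i | i <- enum 'I_n] sq0.
pose u : 'rV[R]_n := \row_i q (delta_mx 0 i).
have qle x : q x <= dotv u x.
  rewrite {1}[x]row_sum_delta /dotv.
  apply: (@big_ind2 _ _ (fun (v : 'rV[R]_n) c => q v <= c)).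
  - by rewrite sublinear0.
  - by move=> v c w d vc wd; apply: le_trans (sq.1 _ _) (lerD vc wd).
  move=> i _; rewrite mxE mulrC.
  have [xi|xi|->] := ltgtP (x ord0 i) 0.
  - rewrite -[_ *: _]opprK -scalerN -scaleNr sublinearZ ?oppr_gt0//.
    by rewrite qb ?mulrNN//; apply/mapP; exists i; rewrite ?mem_enum.
  - by rewrite sublinearZ.
  - by rewrite scale0r sublinear0// mul0r.
have uq x : dotv u x = q x.
  apply/eqP; rewrite eq_le qle andbT.
  by have := qle (- x); rewrite dotvNr; have := sublinearN x sq; lra.
exists u => [h|]; rewrite uq; first exact: le_trans (q0p h).
by have := sublinearN h0 sq; have := qq0 h0; have := qq0 (- h0); lra.
Qed.

End HahnBanach.

(** * Convex conjugation *)

Section ConvexConjugate.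
Context {R : realType} {n : nat}.
Implicit Types (f psi : 'rV[R]_n -> \bar R) (x y : 'rV[R]_n).

Lemma conv_ey (t : R) (a : \bar R) : 0 < t < 1 -> a != -oo%E ->
  ((1 - t)%:E * a + t%:E * +oo = +oo)%E.
Proof.
move=> /andP[t0 t1] aNy; rewrite gt0_muley ?lte_fin//; case: a aNy => [b||]// _.
by rewrite gt0_muley ?lte_fin ?subr_gt0.
Qed.

Lemma conv_ye (t : R) (a : \bar R) : 0 < t < 1 -> a != -oo%E ->
  ((1 - t)%:E * +oo + t%:E * a = +oo)%E.
Proof.
move=> /andP[t0 t1] aNy; rewrite gt0_muley ?lte_fin ?subr_gt0//.
by case: a aNy => [b||]// _; rewrite gt0_muley ?lte_fin.
Qed.

Definition int_dom f x : Prop :=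
  exists2 r : R, 0 < r & forall y, sqn (y - x) < r ^+ 2 -> (f y < +oo)%E.

Lemma int_dom_open f x : int_dom f x ->
  exists2 r : R, 0 < r & forall y, sqn (y - x) < r ^+ 2 -> int_dom f y.
Proof.
move=> [r r0 rP]; exists (r / 2); first by rewrite divr_gt0.
move=> y yx; exists (r / 2); first by rewrite divr_gt0.
move=> z zy; apply: rP.
have -> : z - x = (z - y) + (y - x) by rewrite addrA subrK.
have := sqnD_le (z - y) (y - x).
rewrite !expr2 in yx zy *; nra.
Qed.

Lemma int_dom_fin f x : convex_fun f -> int_dom f x -> exists a, f x = a%:E.
Proof.
move=> [fNy _] [r r0 /(_ x)]; rewrite subrr sqn0 exprn_gt0// => /(_ isT).
by have := fNy x; case: (f x) => // a; exists a.
Qed.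

Lemma convex_fun_fin f x y (a b t : R) : convex_fun f -> 0 < t < 1 ->
  (f x <= a%:E)%E -> (f y <= b%:E)%E ->
  (f ((1 - t) *: x + t *: y)%R <= ((1 - t) * a + t * b)%:E)%E.
Proof.
move=> [_ cf] /[dup] t01 /andP[t0 t1] fx fy; apply: le_trans (cf _ _ _ t01) _.
rewrite [((1 - t) * a + t * b)%:E]EFinD !EFinM.
by apply: leeD; apply: lee_wpmul2l => //; rewrite lee_fin; lra.
Qed.

(* The infimum of the admissible slopes [c] in the direction [h] is sublinear;
   a linear functional below it is the required affine minorant. *)
Lemma convex_minorant f x0 h0 (m : R) : convex_fun f -> (0 <= f x0)%E ->
  int_dom f x0 -> (forall s, 0 < s -> ((s * m)%:E <= f (x0 + s *: h0)%R)%E) ->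
  exists2 u, forall y, ((dotv u (y - x0))%:E <= f y)%E & m <= dotv u h0.
Proof.
move=> cf f0 [r r0 rP] h0P.
pose S h := [set c | exists2 s : R, 0 < s & (f (x0 + s *: h)%R <= (s * c)%:E)%E].
have S_neq0 h : S h !=set0.
  have [t /andP[t0 _] tP] := sqn_small h r0.
  have : (f (x0 + t *: h)%R < +oo)%E.
    by apply: rP; rewrite addrAC subrr add0r tP// lexx ltW.
  have := cf.1 (x0 + t *: h); case E : (f _) => [c||]// _ _.
  by exists (c / t), t => //; rewrite E lee_fin mulrC divfK ?gt_eqF.
have SD h h' c c' : S h c -> S h' c' -> S (h + h') (c + c').
  move=> [s s0 sc] [s' s'0 sc']; have ss : 0 < s + s' by rewrite addr_gt0.
  exists (s * s' / (s + s')); first by rewrite !divr_gt0 ?mulr_gt0.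
  have t01 : 0 < s / (s + s') < 1.
    by rewrite divr_gt0//= ltr_pdivrMr// mul1r ltrDl.
  have := convex_fun_fin cf t01 sc sc'.
  have ssE : s + s' != 0 by rewrite gt_eqF.
  have -> : (1 - s / (s + s')) *: (x0 + s *: h) + s / (s + s') *: (x0 + s' *: h') =
      x0 + (s * s' / (s + s')) *: (h + h').
    rewrite !scalerDr !scalerA addrACA -scalerDl subrK scale1r.
    by congr (_ + (_ *: _ + _ *: _)); field.
  by congr (_ <= _%:E)%E; field.
have SZ t h c : 0 < t -> S h c -> S (t *: h) (t * c).
  move=> t0 [s s0 sc]; exists (s / t); first by rewrite divr_gt0.
  by rewrite scalerA mulrA divfK ?gt_eqF.
have S0 c : S 0 c -> 0 <= c.
  move=> [s s0]; rewrite scaler0 addr0 => /(le_trans f0).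
  by rewrite lee_fin pmulr_rge0.
have lbS h : has_lbound (S h).
  have [c' c'P] := S_neq0 (- h); exists (- c') => c cP.
  by have := SD _ _ _ _ cP c'P; rewrite subrr => /S0; lra.
pose p h := inf (S h).
have ple h c : S h c -> p h <= c by move=> hc; exact: ge_inf.
have lep c h : (forall d, S h d -> c <= d) -> c <= p h by move=> H; exact: lb_le_inf.
have sp : sublinear p.
  split => [x y|t x t0].
    rewrite -lerBlDr; apply: (lep) => c xc.
    suff : p (x + y) - c <= p y by lra.
    by apply: (lep) => d yd; have := ple _ _ (SD _ _ _ _ xc yd); lra.
  rewrite -ler_pdivrMl//; apply: (lep) => c xc; rewrite ler_pdivrMl//.
  exact/ple/SZ.
have [u up uh0] := hahn_banach_rv h0 sp.
exists u; last first.
  rewrite uh0; apply: (lep) => c [s s0 /(le_trans (h0P _ s0))].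
  by rewrite lee_fin ler_pM2l.
move=> y; have := cf.1 y; case E : (f y) => [c||]// _; last exact: leey.
rewrite lee_fin; apply: le_trans (up _) (ple _ _ _).
by exists 1 => //; rewrite scale1r addrC subrK E mul1r.
Qed.

Lemma subgradient_exists f x a : convex_fun f -> int_dom f x -> f x = a%:E ->
  exists u, forall y, ((a + dotv u (y - x))%:E <= f y)%E.
Proof.
move=> cf [r r0 rP] fx.
pose g y := (f y - a%:E)%E.
have yE : (+oo - a%:E = +oo)%E by [].
have [|||s s0|u uP _] := @convex_minorant g x 0 0.
- split => [y|y z t t01]; first by rewrite /g; have := cf.1 y; case: (f y).
  have /andP[t0 t1] := t01.
  have := cf.2 y z t t01; have := cf.1 ((1 - t) *: y + t *: z).
  have := cf.1 y; have := cf.1 z; rewrite /g.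
  have t10 : 0 < 1 - t by lra.
  case: (f y) => [b||]//; case: (f z) => [c||]// _ _.
  + case: (f _) => [d||]// _; by rewrite -!EFinM -!EFinD !lee_fin; lra.
  + by move=> _ _; rewrite yE conv_ey ?leey.
  + by move=> _ _; rewrite yE conv_ye ?leey.
  + by move=> _ _; rewrite yE conv_ye ?leey.
- by rewrite /g fx subee.
- exists r => // y /rP; rewrite /g; have := cf.1 y; case: (f y) => // b _ _.
  by rewrite -EFinB ltry.
- by rewrite scaler0 addr0 /g fx subee// mulr0.
exists u => y; have := uP y; rewrite /g; have := cf.1 y.
by case: (f y) => [b||]// _; rewrite ?leey// -EFinB !lee_fin; lra.
Qed.

Lemma legendre_ge f x y : ((dotv x y)%:E - f x <= legendre f y)%E.
Proof. by apply: ereal_sup_ubound; exists x. Qed.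

Lemma legendre_le f y (b : \bar R) :
  (forall x, ((dotv x y)%:E - f x <= b)%E) -> (legendre f y <= b)%E.
Proof. by move=> H; apply: ge_ereal_sup => _ [x _ <-]. Qed.

Lemma legendre_subgradient f x v (a : R) : f x = a%:E ->
  (forall y, ((a + dotv v (y - x))%:E <= f y)%E) ->
  legendre f v = (dotv x v - a)%:E.
Proof.
move=> fx H; apply/eqP; rewrite eq_le; apply/andP; split.
  apply: legendre_le => y; have := H y; case: (f y) => [b||]//; last by rewrite leNye.
  by rewrite -EFinB !lee_fin !dotv_lin !(dotvC v); lra.
by have := legendre_ge f x v; rewrite fx.
Qed.

Lemma bilegendre_le f x : f x != -oo%E -> (legendre (legendre f) x <= f x)%E.
Proof.
move=> fx; apply: legendre_le => y; move: fx; have := legendre_ge f x y.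
case: (f x) => [b||]// + _; last by rewrite leey.
rewrite dotvC -EFinB; case: (legendre f y) => [c||]//; last by rewrite leNye.
by rewrite -EFinB !lee_fin; lra.
Qed.

Lemma bilegendre_int f x : convex_fun f -> int_dom f x ->
  legendre (legendre f) x = f x.
Proof.
move=> cf ix; have [a fx] := int_dom_fin cf ix.
have [u uP] := subgradient_exists cf ix fx.
apply/eqP; rewrite eq_le bilegendre_le ?fx//=.
have := legendre_ge (legendre f) u x.
rewrite (legendre_subgradient fx uP) -EFinB; apply: le_trans.
by rewrite lee_fin dotvC; lra.
Qed.

Lemma legendre_convex f x1 (a : R) : convex_fun f -> f x1 = a%:E ->
  convex_fun (legendre f).
Proof.
move=> cf fx1; split => [y|y z t /[dup] t01 /andP[t0 t1]].
  by have := legendre_ge f x1 y; rewrite fx1 -EFinB; case: (legendre f y).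
apply: legendre_le => x; have := cf.1 x; have := legendre_ge f x y; have := legendre_ge f x z.
case: (f x) => [b||]//; last by rewrite !leNye.
have t10 : 0 < 1 - t by lra.
rewrite -!EFinB; case: (legendre f y) => [c||]//; case: (legendre f z) => [d||]//.
- by rewrite -!EFinM -EFinD !lee_fin !dotv_lin; nra.
- by rewrite conv_ey ?leey.
- by rewrite conv_ye ?leey.
- by rewrite conv_ye ?leey.
Qed.

(* If [x] were not interior to the domain of [psi], a functional separating it
   would make [psi**] infinite just beyond [x]. *)
Lemma int_dom_bilegendre psi x : classC psi ->
  int_dom (legendre (legendre psi)) x -> int_dom psi x.
Proof.
move=> [cpsi [x1 [r1 [r10 r1P]]]] [r r0 rP].
have i1 : int_dom psi x1 by exists r1.
have [a psix1] := int_dom_fin cpsi i1.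
have [[s s1 sP]|nP] := pselect (exists2 s, 1 < s & (psi (x1 + s *: (x - x1))%R < +oo)%E).
  have s0 : 0 < s by lra.
  exists (r1 * (1 - s^-1)); first by rewrite mulr_gt0// subr_gt0 invf_lt1.
  move=> y yx; have s10 : 0 < 1 - s^-1 by rewrite subr_gt0 invf_lt1.
  pose z := x1 + (1 - s^-1)^-1 *: (y - x).
  have : (psi z < +oo)%E.
    apply: r1P; rewrite /z addrAC subrr add0r sqnZ.
    by rewrite exprVn ltr_pdivrMl ?exprn_gt0// mulrC -exprMn.
  have -> : y = (1 - s^-1) *: z + s^-1 *: (x1 + s *: (x - x1)).
    rewrite /z !scalerDr !scalerA mulVf ?gt_eqF// divff ?gt_eqF// !scale1r.
    by rewrite addrACA -scalerDl subrK scale1r (addrA (y - x)) subrK addrC subrK.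
  have := cpsi.1 z; have := cpsi.1 (x1 + s *: (x - x1)); move: sP.
  case E1 : (psi (x1 + _)) => [c||]// _ _; case E2 : (psi z) => [d||]// _ _.
  have t01 : 0 < s^-1 < 1 by rewrite invr_gt0 s0 invf_lt1.
  have := @convex_fun_fin psi z (x1 + s *: (x - x1)) d c s^-1 cpsi t01.
  by rewrite E1 E2 !lexx => /(_ isT isT) /le_lt_trans; apply; rewrite ltry.
exfalso.
pose g y : \bar R := if `[< (psi y < +oo)%E >] then 1%:E else +oo%E.
have [|||s s0|u uP u1] := @convex_minorant g x1 (x - x1) 1.
- split => [y|y z t /[dup] t01 /andP[t0 t1]]; first by rewrite /g; case: ifP.
  rewrite /g; have t10 : 0 < 1 - t by lra.
  have [yP|yP] := asboolP (psi y < +oo)%E; have [zP|zP] := asboolP (psi z < +oo)%E.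
  + rewrite asboolT.
      by rewrite -!EFinM -EFinD lee_fin; lra.
    move: yP zP; have := cpsi.1 y; have := cpsi.1 z.
    case Ey : (psi y) => [c||]//; case Ez : (psi z) => [d||]// _ _ _ _.
    have := @convex_fun_fin psi y z c d t cpsi t01.
    by rewrite Ey Ez !lexx => /(_ isT isT) /le_lt_trans; apply; rewrite ltry.
  + by rewrite conv_ey ?leey.
  + by rewrite conv_ye ?leey.
  + by rewrite conv_ye ?leey.
- by rewrite /g; case: ifP; rewrite ?lee_fin ?leey.
- by exists r1 => // y /r1P yP; rewrite /g asboolT// ltry.
- rewrite /g mulr1; have [sP|_] := asboolP (psi _ < +oo)%E; last by rewrite leey.
  by rewrite lee_fin leNgt; apply/negP => s1; apply: nP; exists s.
have [v vP] := subgradient_exists cpsi i1 psix1.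
have [e /andP[e0 _] eP] := sqn_small (x - x1) r0.
pose x' := x + e *: (x - x1).
have x'oo : (legendre (legendre psi) x' < +oo)%E.
  by apply: rP; rewrite addrAC subrr add0r eP// lexx ltW.
have key (k : R) : 0 < k ->
    ((dotv v (x' - x1) + a + k * e)%:E <= legendre (legendre psi) x')%E.
  move=> k0; have conj : (legendre psi (v + k *: u) <= (dotv x1 (v + k *: u) + k - a)%:E)%E.
    apply: legendre_le => y; have := uP y; have := vP y; rewrite /g.
    have := cpsi.1 y; case: (psi y) => [b||]// _; last by rewrite leNye.
    rewrite ltry asboolT// -EFinB !lee_fin !dotv_lin !(dotvC y) !(dotvC x1).
    by nra.
  have := legendre_ge (legendre psi) (v + k *: u) x'; apply: le_trans.
  move: conj; case: (legendre psi (v + k *: u)) => [c||]//; last by rewrite leey.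
  rewrite -EFinB !lee_fin.
  have : 0 <= k * e * (dotv u (x - x1) - 1).
    by rewrite mulr_ge0 ?subr_ge0// mulr_ge0 ?ltW.
  have : 0 <= k * (dotv u (x - x1) - 1) by rewrite mulr_ge0 ?subr_ge0// ltW.
  rewrite /x' !dotv_lin !(dotvC x1); nra.
move: x'oo key; case: (legendre _ x') => [K||]// _ /=; last by move=> /(_ 1 ltr01).
move=> /(_ ((`|K - dotv v (x' - x1) - a| + 1) / e)).
rewrite divr_gt0 ?ltr_wpDl// => /(_ isT); rewrite divfK ?gt_eqF// lee_fin.
by have := ler_norm (K - dotv v (x' - x1) - a); lra.
Qed.

End ConvexConjugate.

(** * Second-order expansions *)

Section Alexandrov.
Context {R : realType} {n : nat}.
Implicit Types (f psi : 'rV[R]_n -> \bar R) (x y v : 'rV[R]_n) (A B : 'M[R]_n).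

Lemma alex_int_dom f x v A : alex_at f x v A -> int_dom f x.
Proof.
move=> [_ [r [_ /(_ 1 ltr01)[d [d0 dP]]]]]; exists d => // y /dP[s [-> _]].
exact: ltry.
Qed.

Lemma alex_subgradient f x v A (a : R) : convex_fun f -> alex_at f x v A ->
  f x = a%:E -> forall y, ((a + dotv v (y - x))%:E <= f y)%E.
Proof.
move=> cf [_ [r [fx /(_ 1 ltr01)[d [d0 dP]]]]]; rewrite fx => -[ra] y.
subst r; have := cf.1 y; case fy : (f y) => [b||]// _; last exact: leey.
rewrite lee_fin leNgt; apply/negP => gap.
set h := y - x in gap *; set q := dotv (h *m A) h.
have [t0 /andP[t00 t01] t0P] := sqn_small h d0.
set K := sqn h + `|q|; have K0 : 0 <= K by rewrite addr_ge0 ?sqn_ge0.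
set G := a + dotv v h - b; have G0 : 0 < G by rewrite subr_gt0.
pose t := Num.min t0 (G / (2 * (K + 1))).
have t_gt0 : 0 < t by rewrite lt_min t00 divr_gt0// mulr_gt0// ltr_wpDl.
have tt0 : t <= t0 by rewrite ge_min lexx.
have tG : t * (2 * (K + 1)) <= G.
  by rewrite -ler_pdivlMr ?mulr_gt0 ?ltr_wpDl// ge_min lexx orbT.
have t1 : 0 < t < 1 by rewrite t_gt0 (le_lt_trans tt0).
have xtE : (1 - t) *: x + t *: y - x = t *: h.
  by rewrite scalerBl scale1r addrAC [x - _]addrC addrK /h scalerBr addrC.
have [|s [fs]] := dP ((1 - t) *: x + t *: y).
  by rewrite xtE t0P// ltW.
have := @convex_fun_fin _ _ f x y a b t cf t1.
rewrite fx fy fs !lexx => /(_ isT isT); rewrite lee_fin => sle.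
rewrite xtE sqnZ -scalemxAl !(dotvZl, dotvZr) -/q ler_norml => /andP[sge _].
have tq : t * (2^-1 * q) <= t * `|q|.
  by rewrite ler_pM2l//; have := ler_norm q; have := normr_ge0 q; lra.
have tq' : - (t * `|q|) <= t * (2^-1 * q).
  by rewrite -mulrN ler_pM2l//; have := ler_norm (- q); rewrite normrN; have := normr_ge0 q; lra.
have H : t * G <= t * (t * K).
  move: sge; rewrite /G /K !expr2.
  have : t * (- (t * `|q|)) <= t * (t * (2^-1 * q)) by rewrite ler_pM2l.
  by nra.
have : G <= t * K by rewrite -(ler_pM2l t_gt0).
by nra.
Qed.

Lemma legendre_alex f x v A (a : R) : convex_fun f -> alex_at f x v A ->
  f x = a%:E -> legendre f v = (dotv x v - a)%:E.
Proof.
move=> cf al fx; exact: legendre_subgradient fx (alex_subgradient cf al fx).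
Qed.

Lemma alex_local f g x v A :
  (exists2 r : R, 0 < r & forall y, sqn (y - x) < r ^+ 2 -> f y = g y) ->
  alex_at f x v A -> alex_at g x v A.
Proof.
move=> [r r0 fg] [symA [a [fx al]]]; split => //; exists a; split.
  by rewrite -fg// subrr sqn0 exprn_gt0.
move=> e /al[d [d0 dP]]; exists (Num.min d r); split; first by rewrite lt_min d0.
move=> y yx.
have yd : sqn (y - x) < d ^+ 2.
  apply: lt_le_trans yx _; rewrite ler_pXn2r ?nnegrE ?le_min ?ge_min ?lexx ?(ltW d0) ?(ltW r0)//.
have yr : sqn (y - x) < r ^+ 2.
  apply: lt_le_trans yx _.
  by rewrite ler_pXn2r ?nnegrE ?le_min ?ge_min ?lexx ?orbT ?(ltW d0) ?(ltW r0)//.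
by rewrite -fg//; exact: dP.
Qed.

Lemma bilegendre_local psi x : convex_fun psi -> int_dom psi x ->
  exists2 r : R, 0 < r &
    forall y, sqn (y - x) < r ^+ 2 -> psi y = legendre (legendre psi) y.
Proof.
move=> cpsi /int_dom_open[r r0 rP]; exists r => // y /rP iy.
by rewrite bilegendre_int.
Qed.

Lemma alex_bilegendre psi x v A : classC psi ->
  alex_at (legendre (legendre psi)) x v A <-> alex_at psi x v A.
Proof.
move=> cC; split => al.
  have [r r0 rP] := bilegendre_local cC.1 (int_dom_bilegendre cC (alex_int_dom al)).
  by apply: alex_local al; exists r => // y /rP.
exact: alex_local (bilegendre_local cC.1 (alex_int_dom al)) al.
Qed.

Lemma alex_dataP f x : has_alex f x -> alex_at f x (grad f x) (hess f x).
Proof.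
move=> [v [A al]]; rewrite /grad /hess /alex_data.
by case: xgetP => [[w B] _ //|/(_ (v, A))/(_ al)].
Qed.

Lemma Xset_fin f x : Xset f x -> exists a, f x = a%:E.
Proof. by move=> [_ [[v [A [_ [a [fx _]]]]] _]]; exists a. Qed.

Lemma Xset_bilegendre psi : classC psi -> Xset (legendre (legendre psi)) = Xset psi.
Proof.
move=> cC; apply/seteqP.
have data x : alex_data (legendre (legendre psi)) x = alex_data psi x.
  rewrite /alex_data; congr xget; apply/seteqP.
  by split => p; apply alex_bilegendre.
split => x [_ [[v [A al]] u]]; (split; last split).
- by move/(alex_bilegendre _ _ _ cC): al => [_ [a [-> _]]]; exact: ltry.
- by exists v, A; apply/alex_bilegendre.
- by rewrite /hess -data.
- by move/(alex_bilegendre _ _ _ cC): al => [_ [a [-> _]]]; exact: ltry.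
- by exists v, A; apply/alex_bilegendre.
- by rewrite /hess data.
Qed.

Lemma sqn_mulmx_le (M : 'M[R]_n) : exists2 C : R, 0 <= C &
  forall k : 'rV[R]_n, sqn (k *m M) <= C * sqn k.
Proof.
exists (\sum_j sqn (row j M^T)); first by apply: sumr_ge0 => j _; exact: sqn_ge0.
move=> k; rewrite mulr_suml; apply: ler_sum => j _.
rewrite -expr2 mulrC (_ : (k *m M) ord0 j = dotv k (row j M^T)) ?cauchy_schwarz//.
by rewrite mxE; apply: eq_bigr => i _; rewrite !mxE.
Qed.

Lemma psd_coercive B : B^T = B -> (forall h, 0 <= dotv (h *m B) h) ->
  B \in unitmx -> exists2 c : R, 0 < c & forall h, c * sqn h <= dotv (h *m B) h.
Proof.
move=> symB psdB uB.
have [C C0 CP] := sqn_mulmx_le B; have [D D0 DP] := sqn_mulmx_le (invmx B).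
have C10 : 0 < C + 1 by lra.
have D10 : 0 < (C + 1) * (D + 1) by rewrite mulr_gt0//; lra.
exists ((C + 1) * (D + 1))^-1; first by rewrite invr_gt0.
move=> h; rewrite ler_pdivrMl//.
set k := h *m B; set q := dotv k h.
have qk : dotv (k *m B) k <= (C + 1) * sqn k.
  by have := dotv_le_sqn (k *m B) k; have := CP k; have := sqn_ge0 k; nra.
have sk : sqn k <= (C + 1) * q.
  have := psdB (h - (C + 1)^-1 *: k).
  rewrite mulmxBl -scalemxAl !dotv_lin -/k -/q.
  rewrite [dotv (k *m B) h]dotv_mulmxl symB -/k -/(sqn k) => H.
  have : (C + 1)^-1 * ((C + 1)^-1 * dotv (k *m B) k) <= (C + 1)^-1 * sqn k.
    by rewrite ler_pM2l ?invr_gt0// ler_pdivrMl.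
  move=> H'; rewrite -ler_pdivrMl//; move: H H'.
  by set P := _ * sqn k; set Q := _ * (_ * _); lra.
have : sqn h <= D * sqn k by have := DP k; rewrite /k mulmxK.
have := sqn_ge0 k; nra.
Qed.

(* Non-degeneracy of the Hessian makes [f] grow at least linearly away from
   [y], with slope bounded below, once [<x, .>] is subtracted. *)
Lemma alex_legendre_int_dom f x y B : convex_fun f -> alex_at f y x B ->
  B \in unitmx -> int_dom (legendre f) x.
Proof.
move=> cf al uB; have [symB [a [fy alB]]] := al.
have sub := alex_subgradient cf al fy.
have psdB h : 0 <= dotv (h *m B) h.
  rewrite leNgt; apply/negP => q0; set q := dotv _ h in q0.
  pose e := - q / (4 * (sqn h + 1)).
  have h1 : 0 < sqn h + 1 by rewrite ltr_wpDl ?sqn_ge0.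
  have e0 : 0 < e by rewrite divr_gt0 ?oppr_gt0// mulr_gt0.
  have [d [d0 dP]] := alB _ e0.
  have [t /andP[t0 _] tP] := sqn_small h d0.
  have yt : y + t *: h - y = t *: h by rewrite addrAC subrr add0r.
  have [|s [fs]] := dP (y + t *: h); first by rewrite yt tP// lexx ltW.
  have := sub (y + t *: h); rewrite fs yt lee_fin sqnZ -scalemxAl !dotv_lin -/q => sle.
  rewrite ler_norml => /andP[_ sge].
  have t20 : 0 < t ^+ 2 by rewrite exprn_gt0.
  have : t ^+ 2 * (- (2^-1 * q)) <= t ^+ 2 * (e * sqn h) by move: sge; rewrite expr2; nra.
  rewrite ler_pM2l//.
  have : e * sqn h <= - q / 4.
    have -> : - q / 4 = e * (sqn h + 1) by rewrite /e; field; rewrite gt_eqF.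
    by rewrite ler_pM2l//; lra.
  by lra.
have [c c0 cP] := psd_coercive symB psdB uB.
have c40 : 0 < c / 4 by rewrite divr_gt0.
have [d [d0 dP]] := alB _ c40.
have d20 : 0 < d / 2 by rewrite divr_gt0.
exists (c / 4 * (d / 2)); first by rewrite mulr_gt0.
move=> x' x'x.
suff : (legendre f x' <= (dotv y x' - a + (sqn (x' - x) + d ^+ 2) / 2)%:E)%E.
  by move=> /le_lt_trans; apply; rewrite ltry.
apply: legendre_le => z; have := cf.1 z; case fz : (f z) => [b||]// _; last by rewrite leNye.
rewrite -EFinB lee_fin.
set k := z - y.
have subz : a + dotv x k <= b by have := sub z; rewrite fz lee_fin.
have zE : dotv z x' = dotv y x' + dotv x k + dotv (x' - x) k.
  by rewrite /k !dotv_lin (dotvC z) (dotvC y); ring.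
rewrite zE.
have [kd|dk] := ltP (sqn k) (d ^+ 2).
  by have := dotv_le_sqn (x' - x) k; lra.
set N := Num.sqrt (sqn k).
have N2 : N ^+ 2 = sqn k by rewrite sqr_sqrtr ?sqn_ge0.
have N0 : 0 < N by rewrite sqrtr_gt0 (lt_le_trans _ dk)// exprn_gt0.
have dN : d <= N.
  by rewrite -(@ler_pXn2r _ 2)// ?nnegrE ?N2 ?(ltW N0) ?(ltW d0).
pose t := d / 2 / N.
have tN : t * N = d / 2 by rewrite /t divfK ?gt_eqF.
have t01 : 0 < t < 1 by rewrite divr_gt0//= ltr_pdivrMr//; lra.
have /andP[t0 t1] := t01.
have yzE : (1 - t) *: y + t *: z - y = t *: k.
  by rewrite scalerBl scale1r addrAC [y - _]addrC addrK /k scalerBr addrC.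
have tk : sqn (t *: k) = (d / 2) ^+ 2 by rewrite sqnZ -N2 -exprMn tN.
have [|s [fs]] := dP ((1 - t) *: y + t *: z).
  by rewrite yzE tk ltr_pXn2r ?nnegrE ?(ltW d20) ?(ltW d0)//; lra.
have := @convex_fun_fin _ _ f y z a b t cf t01.
rewrite fy fz fs !lexx => /(_ isT isT); rewrite lee_fin => sle.
rewrite yzE ler_norml => /andP[sge _].
have ctk := cP (t *: k).
have grow : t * (c / 4 * (d / 2) * N) <= t * (b - a - dotv x k).
  have : c / 4 * sqn (t *: k) <= s - a - dotv x (t *: k) by lra.
  by rewrite tk dotvZr -{1}tN; nra.
have {grow} : c / 4 * (d / 2) * N <= b - a - dotv x k by rewrite -(ler_pM2l t0).
have : dotv (x' - x) k <= c / 4 * (d / 2) * N.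
  rewrite leNgt; apply/negP => H.
  have := cauchy_schwarz (x' - x) k; rewrite leNgt => /negP; apply.
  apply: le_lt_trans (_ : (c / 4 * (d / 2) * N) ^+ 2 < _).
    by rewrite exprMn N2 ler_wpM2r ?sqn_ge0// ltW.
  have M0 := mulr_ge0 (mulr_ge0 (ltW c40) (ltW d20)) (ltW N0).
  by rewrite ltr_pXn2r// nnegrE (le_trans M0 (ltW H)).
have := sqn_ge0 (x' - x); have := exprn_gt0 2 d0; lra.
Qed.

End Alexandrov.

(** * Bounds for the functional G *)

Section UpperBound.
Context {R : realType} {n : nat}.
Implicit Types (psi : 'rV[R]_n -> \bar R) (F : R -> R) (g : 'rV[R]_n -> R).

Lemma intR_eq (A : set 'rV[R]_n) (f g : 'rV[R]_n -> R) :
  (forall x, A x -> f x = g x) -> intR A f = intR A g.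
Proof.
move=> fg; congr iint; apply/funext => x.
by have [/fg ->|] := asboolP (A x).
Qed.

Lemma Gfun_le (p : R) F1 F2 psi g : 0 <= p -> Lclass psi g ->
  (Gfun p F1 F2 psi <= Vfun p F1 F2 psi g `^ (n%:R / (n%:R + p)) *
                       I_on (legendre psi) g `^ (p / (n%:R + p)))%E.
Proof. by move=> p0 Lg; rewrite /Gfun p0; apply: ereal_inf_lbound; exists g. Qed.

Lemma Gfun_ge0 (p : R) F1 F2 psi : 0 <= p -> (0 <= Gfun p F1 F2 psi)%E.
Proof.
move=> p0; rewrite /Gfun p0; apply: le_ereal_inf_tmp => _ [g _ <-].
by rewrite mule_ge0// poweR_ge0.
Qed.

Lemma Vfun_legendre (p : R) F1 F2 psi : convex_fun psi ->
  (forall y, (legendre psi y < +oo)%E -> 0 < Fcomp F2 (legendre psi) y) ->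
  Vfun p F1 F2 psi (Fcomp F2 (legendre psi)) = I_on psi (Fcomp F1 psi).
Proof.
move=> cpsi F2_gt0; apply: intR_eq => x Xx.
have [a psix] := Xset_fin Xx; have [_ [/alex_dataP al _]] := Xx.
have leg := legendre_alex cpsi al psix.
have := F2_gt0 (grad psi x); rewrite /Fcomp leg psix ltry => /(_ isT) F20.
by rewrite /= divff ?gt_eqF// powR1 mul1r.
Qed.

Lemma Gfun_le_legendre (p : R) F1 F2 psi : 0 <= p -> convex_fun psi ->
  (forall y, (legendre psi y < +oo)%E -> 0 < Fcomp F2 (legendre psi) y) ->
  log_concave (Fcomp F2 (legendre psi)) ->
  (0 < I_on (legendre psi) (Fcomp F2 (legendre psi)) < +oo)%E ->
  (Gfun p F1 F2 psi <= I_on psi (Fcomp F1 psi) `^ (n%:R / (n%:R + p)) *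
     I_on (legendre psi) (Fcomp F2 (legendre psi)) `^ (p / (n%:R + p)))%E.
Proof.
move=> p0 cpsi F2_gt0 lc I2; rewrite -(Vfun_legendre p F1 cpsi F2_gt0).
by apply: Gfun_le => //; split => //; split => // y [/F2_gt0].
Qed.

Lemma Vfun_legendre_dual (p : R) F1 F2 psi : (forall t, 0 < F1 t) -> classC psi ->
  Vfun p F2 F1 (legendre psi) (Fcomp F1 psi) =
  I_on (legendre psi) (Fcomp F2 (legendre psi)).
Proof.
move=> F1_gt0 cC; apply: intR_eq => y Xy.
have [x1 [r1 [r10 r1P]]] := cC.2.
have [a psix1] : exists a, psi x1 = a%:E by apply: (int_dom_fin cC.1); exists r1.
have cl := legendre_convex cC.1 psix1.
have [b psiy] := Xset_fin Xy; have [_ [/alex_dataP al u]] := Xy.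
have leg := legendre_alex cl al psiy.
have ix := int_dom_bilegendre cC (alex_legendre_int_dom cl al u).
rewrite /Fcomp psiy -(bilegendre_int cC.1 ix) leg /=.
by rewrite divff ?gt_eqF// powR1 mul1r.
Qed.

Lemma Gfun_le_dual (p : R) F1 F2 psi : 0 <= p -> (forall t, 0 < F1 t) ->
  classC psi -> log_concave (Fcomp F1 psi) ->
  (0 < I_on psi (Fcomp F1 psi) < +oo)%E ->
  (Gfun p F2 F1 (legendre psi) <=
     I_on (legendre psi) (Fcomp F2 (legendre psi)) `^ (n%:R / (n%:R + p)) *
     I_on psi (Fcomp F1 psi) `^ (p / (n%:R + p)))%E.
Proof.
move=> p0 F1_gt0 cC lc I1; rewrite -(Vfun_legendre_dual p F2 F1_gt0 cC).
have IE g : I_on (legendre (legendre psi)) g = I_on psi g.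
  by rewrite /I_on Xset_bilegendre.
rewrite -[X in (_ <= _ * X `^ _)%E]IE; apply: Gfun_le => //; split => //; split.
  move=> x; rewrite Xset_bilegendre// => /Xset_fin[a psix].
  by rewrite /Fcomp psix.
by rewrite IE.
Qed.

End UpperBound.

Section Quadratic.
Context {R : realType} {n : nat}.
Implicit Types (A : 'M[R]_n) (x y : 'rV[R]_n).

Definition quad A (a : R) x : \bar R := (dotv (x *m A) x + a)%:E.

Lemma sqn_eq0 x : sqn x = 0 -> x = 0.
Proof.
move=> x0; apply/rowP => i; rewrite mxE.
have pos (j : 'I_n) : true -> 0 <= x ord0 j * x ord0 j by rewrite -expr2 sqr_ge0.
by have /eqP := psumr_eq0P pos x0 (erefl : xpredT i); rewrite mulf_eq0 orbb => /eqP.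
Qed.

Lemma posdef_ge0 A x : posdef A -> 0 <= dotv (x *m A) x.
Proof.
move=> [_ pA]; have [->|/pA/ltW//] := eqVneq x 0; by rewrite dotv0r.
Qed.

Lemma posdef_unitmx A : posdef A -> A \in unitmx.
Proof.
move=> [_ pA]; rewrite -row_free_unit -kermx_eq0; apply/negPn/negP.
move=> /rowV0Pn[v /sub_kermxP vA v0].
by have := pA v v0; rewrite vA dotv0l ltxx.
Qed.

Lemma posdefZ A (k : R) : 0 < k -> posdef A -> posdef (k *: A).
Proof.
move=> k0 [sA pA]; split; first by rewrite linearZ/= sA.
by move=> x /pA xA; rewrite -scalemxAr dotvZl mulr_gt0.
Qed.

Lemma posdef_inv A : posdef A -> posdef (invmx A).
Proof.
move=> pA; have uA := posdef_unitmx pA; have [sA posA] := pA.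
split; first by rewrite trmx_inv sA.
move=> x x0; have -> : dotv (x *m invmx A) x =
    dotv ((x *m invmx A) *m A) (x *m invmx A) by rewrite mulmxKV// dotvC.
apply: posA; apply: contra_neq x0 => E.
by rewrite -[x](mulmxKV uA) E mul0mx.
Qed.

Lemma quad_expand A x h : A^T = A -> dotv ((x + h) *m A) (x + h) =
  dotv (x *m A) x + 2 * dotv (x *m A) h + dotv (h *m A) h.
Proof.
move=> sA; rewrite mulmxDl !dotv_lin [dotv (h *m A) x]dotv_mulmxl sA (dotvC h).
by ring.
Qed.

Lemma legendre_quad A (a : R) : posdef A ->
  legendre (quad A a) = quad (4^-1 *: invmx A) (- a).
Proof.
move=> pA; have uA := posdef_unitmx pA; apply/funext => y.
set x := 2^-1 *: (y *m invmx A).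
have xA : x *m A = 2^-1 *: y by rewrite /x -scalemxAl mulmxKV.
rewrite (@legendre_subgradient _ _ _ x y (dotv (x *m A) x + a))//.
  rewrite /quad xA -scalemxAr (dotvC _ x) /x !(dotvZl, dotvZr); congr EFin.
  by field.
move=> z; rewrite lee_fin; set h := z - x.
have -> : z = x + h by rewrite addrC subrK.
rewrite quad_expand ?pA.1// xA !(dotvZl _ y).
by have := posdef_ge0 h pA; lra.
Qed.

Lemma quad_convex A (a : R) : posdef A -> convex_fun (quad A a).
Proof.
move=> pA; split=> // x y t /andP[t0 t1].
rewrite /quad -!EFinM -EFinD lee_fin.
have -> : (1 - t) *: x + t *: y = x + t *: (y - x).
  by rewrite scalerBl scale1r scalerBr -!addrA (addrC (- _)).
have yE := quad_expand x (y - x) pA.1.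
rewrite [x + (y - x)]addrC subrK in yE; rewrite yE quad_expand ?pA.1// -scalemxAl !(dotvZl, dotvZr).
have := posdef_ge0 (y - x) pA; set q := dotv ((y - x) *m A) _ => q0.
have t10 : 0 <= 1 - t by lra.
by have := mulr_ge0 (mulr_ge0 (ltW t0) t10) q0; nra.
Qed.

Lemma alex_unique (f : 'rV[R]_n -> \bar R) x v A v' A' :
  alex_at f x v A -> alex_at f x v' A' -> v = v' /\ A = A'.
Proof.
move=> [sA [r [fx al]]] [sA' [r' [fx' al']]].
move: fx'; rewrite fx => -[rr']; subst r'.
pose M := A - A'; pose w := v - v'.
have sM : M^T = M by rewrite linearB/= sA sA'.
have key h (e : R) : 0 < e -> exists2 t0 : R, 0 < t0 & forall t, 0 < t <= t0 ->
    `|t * dotv w h + t ^+ 2 * (2^-1 * dotv (h *m M) h)| <= 2 * e * (t ^+ 2 * sqn h).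
  move=> e0; have [d [d0 dP]] := al _ e0; have [d' [d'0 d'P]] := al' _ e0.
  have [t1 /andP[t10 _] t1P] := sqn_small h d0.
  have [t2 /andP[t20 _] t2P] := sqn_small h d'0.
  exists (Num.min t1 t2); first by rewrite lt_min t10.
  move=> t /andP[t0]; rewrite le_min => /andP[tt1 tt2].
  have xE : x + t *: h - x = t *: h by rewrite addrAC subrr add0r.
  have [|s [fs]] := dP (x + t *: h); first by rewrite xE t1P// ltW.
  have [|s' [fs']] := d'P (x + t *: h); first by rewrite xE t2P// ltW.
  move: fs'; rewrite fs => -[ss']; subst s'.
  rewrite xE -!scalemxAl !(dotvZl, dotvZr) sqnZ => H' H.
  have -> : 2 * e * (t ^+ 2 * sqn h) = e * (t ^+ 2 * sqn h) + e * (t ^+ 2 * sqn h).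
    by ring.
  apply: le_trans (lerD H H'); apply: le_trans (ler_normB _ _).
  rewrite /w /M mulmxBr !(dotvDl, dotvNl) le_eqVlt; apply/orP; left; apply/eqP.
  by rewrite -normrN; congr `|_|; ring.
have q0 h : dotv (h *m M) h = 0.
  apply/eqP; rewrite -normr_eq0 eq_le normr_ge0 andbT.
  apply/ler_addgt0Pr => e e0; rewrite add0r.
  have h1 : 0 < sqn h + 1 by rewrite ltr_wpDl ?sqn_ge0.
  have e'0 : 0 < e / (4 * (sqn h + 1)) by rewrite divr_gt0// mulr_gt0.
  have [t1 t10 t1P] := key h _ e'0; have [t2 t20 t2P] := key (- h) _ e'0.
  pose t := Num.min t1 t2; have t0 : 0 < t by rewrite lt_min t10.
  have := t1P t; have := t2P t; rewrite t0 !ge_min !lexx orbT => /(_ isT) H2 /(_ isT) H1.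
  move: H2; rewrite mulNmx dotvNr !dotvNl dotvNr opprK sqnN => H2.
  have := lerD H1 H2; move/(le_trans (ler_normD _ _)).
  rewrite mulrN addrACA subrr add0r.
  have t20' : 0 < t ^+ 2 by rewrite exprn_gt0.
  have -> : t ^+ 2 * (2^-1 * dotv (h *m M) h) + t ^+ 2 * (2^-1 * dotv (h *m M) h)
     = t ^+ 2 * dotv (h *m M) h by field.
  rewrite normrM (gtr0_norm t20').
  have -> : 2 * (e / (4 * (sqn h + 1))) * (t ^+ 2 * sqn h) +
      2 * (e / (4 * (sqn h + 1))) * (t ^+ 2 * sqn h) =
      t ^+ 2 * (e * (sqn h / (sqn h + 1))) by field; rewrite gt_eqF.
  rewrite ler_pM2l// => /le_trans; apply.
  rewrite ger_pMr// ler_pdivrMr// mul1r; lra.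
have w0 h : dotv w h = 0.
  apply/eqP; rewrite -normr_eq0 eq_le normr_ge0 andbT.
  apply/ler_addgt0Pr => e e0; rewrite add0r.
  have h1 : 0 < sqn h + 1 by rewrite ltr_wpDl ?sqn_ge0.
  have [t1 t10 t1P] := key h 1 ltr01.
  pose t := Num.min t1 (e / (2 * (sqn h + 1))).
  have t0 : 0 < t by rewrite lt_min t10 divr_gt0// mulr_gt0.
  have := t1P t; rewrite t0 ge_min lexx => /(_ isT).
  rewrite q0 !mulr0 addr0 normrM gtr0_norm// mulr1 expr2.
  have -> : 2 * (t * t * sqn h) = t * (t * (2 * sqn h)) by ring.
  rewrite ler_pM2l// => /le_trans; apply.
  have : t * (2 * (sqn h + 1)) <= e.
    by rewrite -ler_pdivlMr ?mulr_gt0// ge_min lexx orbT.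
  by nra.
split.
  by apply/eqP; rewrite -subr_eq0 -/w; apply/eqP/sqn_eq0/w0.
apply/eqP; rewrite -subr_eq0 -/M; apply/eqP/row_matrixP => i; rewrite row0.
apply: sqn_eq0; rewrite rowE; set h := delta_mx 0 i; set k := h *m M.
have := q0 (h + k); rewrite quad_expand// !q0 -/k /sqn; lra.
Qed.

Lemma alex_quad A (a : R) x : A^T = A ->
  alex_at (quad A a) x (2 *: (x *m A)) (2 *: A).
Proof.
move=> sA; split; first by rewrite linearZ/= sA.
exists (dotv (x *m A) x + a); split => // e e0; exists 1; split => // y _.
exists (dotv (y *m A) y + a); split => //; set h := y - x.
have yE := quad_expand x h sA; rewrite [x + h]addrC subrK in yE.
rewrite yE -scalemxAr !dotvZl (_ : _ - _ = 0).
  by rewrite normr0 mulr_ge0 ?sqn_ge0 ?ltW.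
by field.
Qed.

Lemma grad_quad A (a : R) x : A^T = A -> grad (quad A a) x = 2 *: (x *m A).
Proof.
move=> sA; have al := alex_quad a x sA.
have /alex_dataP al' : has_alex (quad A a) x by exists (2 *: (x *m A)), (2 *: A).
by have [] := alex_unique al' al.
Qed.

Lemma Xset_quad A (a : R) : posdef A -> Xset (quad A a) = setT.
Proof.
move=> pA; apply/seteqP; split => // x _; have al := alex_quad a x pA.1.
have ha : has_alex (quad A a) x by exists (2 *: (x *m A)), (2 *: A).
split; first exact: ltry.
split => //; have /alex_dataP al' := ha.
have [_ ->] := alex_unique al' al.
by apply: posdef_unitmx; apply: posdefZ.
Qed.

End Quadratic.

Section LowerBound.
Context {R : realType} {n : nat}.

Lemma gt0_lty_EFin (a : \bar R) : (0 < a < +oo)%E -> exists2 r, 0 < r & a = r%:E.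
Proof.
by case: a => [r||] /andP[]//; rewrite lte_fin => r0 _; exists r.
Qed.

Lemma I_on_quad (A : 'M[R]_n) (a : R) (h : 'rV[R]_n -> R) : posdef A ->
  I_on (quad A a) h = iint (fun x => (h x)%:E).
Proof.
move=> pA; rewrite /I_on /intR Xset_quad//; congr iint; apply/funext => x.
by rewrite asboolT.
Qed.

Lemma Vfun_quad (p : R) (F1 F2 : R -> R) (A : 'M[R]_n) (a : R) g : posdef A ->
  Vfun p F1 F2 (quad A a) g = iint (fun x => let y := x *m (2 *: A) in
    ((Fcomp F2 (legendre (quad A a)) y / g y) `^ (p / n%:R) *
     Fcomp F1 (quad A a) x)%:E).
Proof.
move=> pA; have uA := posdef_unitmx pA.
rewrite /Vfun /intR Xset_quad//; congr iint; apply/funext => x.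
rewrite asboolT// legendre_quad// grad_quad ?pA.1// /Fcomp /=.
rewrite -!scalemxAr -!scalemxAl mulmxK// !(dotvZl, dotvZr) (dotvC x).
by congr ((F2 _ / _) `^ _ * _)%:E; field.
Qed.

Lemma rv_measurable_comp (h : 'rV[R]_n -> \bar R) (M : 'M[R]_n) :
  rv_measurable h -> rv_measurable (fun x => h (x *m M)).
Proof.
move=> mh; have := rv_measurable_affine M 0 mh.
by under eq_fun do rewrite addr0.
Qed.

Lemma Gfun_quad_ge (p : R) (F1 F2 : R -> R) (A : 'M[R]_n) (a k : R) :
  let psi := quad A a in
  (0 < n)%N -> 0 < p -> posdef A -> 0 < k ->
  (forall t, 0 <= t -> F1 (t + a) = k * F2 (t - a)) ->
  (forall t, 0 <= t -> 0 < F2 (t - a)) ->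
  log_concave (Fcomp F1 psi) -> log_concave (Fcomp F2 (legendre psi)) ->
  (I_on (legendre psi) (Fcomp F2 (legendre psi)) < +oo)%E ->
  (I_on psi (Fcomp F1 psi) `^ (n%:R / (n%:R + p)) *
   I_on (legendre psi) (Fcomp F2 (legendre psi)) `^ (p / (n%:R + p))
   <= Gfun p F1 F2 psi)%E.
Proof.
move=> psi n_gt0 p0 pA k0 F12 F2_gt0 lc1 lc2 I2oo.
have n0 : 0 < n%:R :> R by rewrite ltr0n.
have np0 : 0 < n%:R + p by rewrite addr_gt0.
set al := n%:R / (n%:R + p); set be := p / (n%:R + p).
have al0 : 0 < al by rewrite divr_gt0.
have be0 : 0 < be by rewrite divr_gt0.
have ab1 : al + be = 1 by rewrite /al /be; field; rewrite gt_eqF.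
pose B := 4^-1 *: invmx A; have pB : posdef B by apply: posdefZ => //; exact: posdef_inv.
have legE : legendre psi = quad B (- a) by exact: legendre_quad.
pose T : 'M[R]_n := 2 *: A; have pT : posdef T by exact: posdefZ.
have [c c0 cP] := iint_posdef pT.
set f1 := Fcomp F1 psi in lc1 *; set f2 := Fcomp F2 (legendre psi) in lc2 I2oo *.
have f2_gt0 y : 0 < f2 y by rewrite /f2 legE /Fcomp/=; apply/F2_gt0/posdef_ge0.
have f12 x : f1 x = k * f2 (x *m T).
  rewrite /f1 /f2 legE /Fcomp/= F12 ?posdef_ge0//; congr (_ * F2 _); congr (_ + _).
  rewrite /T /B -!scalemxAr -!scalemxAl mulmxK ?posdef_unitmx// !(dotvZl, dotvZr) (dotvC x).
  by field.
have f1_gt0 x : 0 < f1 x by rewrite f12 mulr_gt0.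
have m1 := log_concave_measurable lc1 f1_gt0.
have m2 := log_concave_measurable lc2 f2_gt0.
have I2E : I_on (legendre psi) f2 = iint (fun x => (f2 x)%:E).
  by rewrite legE I_on_quad.
have I1E : I_on psi f1 = ((k * c)%:E * iint (fun x => (f2 x)%:E))%E.
  rewrite I_on_quad// EFinM -muleA -cP//; last by move=> x; rewrite lee_fin ltW.
  rewrite -iintZl ?(ltW k0)//.
  - by congr iint; apply/funext => x; rewrite f12 EFinM.
  - by move=> x; rewrite lee_fin ltW.
  - exact: (rv_measurable_comp T m2).
rewrite I1E I2E; rewrite I2E in I2oo.
have I2_ge0 : (0 <= iint (fun x => (f2 x)%:E))%E.
  by apply: iint_ge0 => x; rewrite lee_fin ltW.
rewrite /Gfun (ltW p0); apply: le_ereal_inf_tmp => _ [g [lg [g0 Ig]] <-].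
rewrite -/psi -/al -/be.
have g_gt0 y : 0 < g y by apply: g0; rewrite legE Xset_quad.
have mg := log_concave_measurable lg g_gt0.
move: Ig; rewrite legE I_on_quad// => Ig.
rewrite Vfun_quad// -/psi -/f1 -/f2 -/T.
set f := fun x => (f2 (x *m T) / g (x *m T)) `^ (p / n%:R) * f1 x.
have -> : iint (fun x => let y := x *m T in
    ((f2 y / g y) `^ (p / n%:R) * f1 x)%:E) = iint (fun x => (f x)%:E) by [].
have f0 x : 0 <= f x by rewrite mulr_ge0 ?powR_ge0// ltW.
have mgT := rv_measurable_comp T mg; have m2T := rv_measurable_comp T m2.
have mf : rv_measurable (fun x => (f x)%:E).
  move=> d D u mu; apply/measurable_EFinP; apply: measurable_funM.
    apply: (measurableT_comp (measurable_powR _)).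
    rewrite (_ : (fun w => _) = (fun w => f2 (\row_i u i w *m T) *
        g (\row_i u i w *m T) `^ (-1))); last first.
      by apply/funext => w; rewrite powR_inv1// ltW.
    apply: measurable_funM; first by apply/measurable_EFinP; exact: m2T.
    apply: (measurableT_comp (measurable_powR _)).
    by apply/measurable_EFinP; exact: mgT.
  by apply/measurable_EFinP; exact: m1.
pose h x := k `^ al * f2 (x *m T).
have hE x : h x = f x `^ al * g (x *m T) `^ be.
  have v0 := f2_gt0 (x *m T); have w0 := g_gt0 (x *m T).
  rewrite /h /f f12; set v := f2 _ in v0 *; set w := g _ in w0 *.
  rewrite powRM ?powR_ge0 ?mulr_ge0 ?ltW// -powRrM.
  have -> : p / n%:R * al = be by rewrite /al /be; field; rewrite !gt_eqF.
  rewrite powRM ?invr_ge0 ?ltW// [(k * v) `^ _]powRM ?ltW//.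
  have -> : w^-1 `^ be = (w `^ be)^-1.
    by rewrite -powR_inv1 ?ltW// -powRrM mulN1r powRN.
  have wb : w `^ be != 0 by rewrite gt_eqF ?powR_gt0.
  have -> : v `^ be / w `^ be * (k `^ al * v `^ al) * w `^ be =
      k `^ al * (v `^ al * v `^ be) by field.
  by rewrite -powRD ?ab1 ?oner_eq0// powRr1 ?ltW.
have ka0 : 0 < k `^ al by rewrite powR_gt0.
have mh : rv_measurable (fun x => (h x)%:E).
  move=> d D u mu; apply/measurable_EFinP; apply: measurable_funM => //.
  by apply/measurable_EFinP; exact: m2T.
have IgT : iint (fun x => (g (x *m T))%:E) = (c%:E * iint (fun x => (g x)%:E))%E.
  by apply: (cP (fun y => (g y)%:E)) => // y; rewrite lee_fin ltW.
have := iint_hoelder al0 be0 ab1 f0 (fun x => ltW (g_gt0 (x *m T))) hE mf mgT mh.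
rewrite IgT.
have -> : iint (fun x => (h x)%:E) =
    ((k `^ al * c)%:E * iint (fun x => (f2 x)%:E))%E.
  rewrite EFinM -muleA -cP//; last by move=> x; rewrite lee_fin ltW.
  rewrite -iintZl ?(ltW ka0)// => x; by rewrite lee_fin ltW.
have [G G0 ->] := gt0_lty_EFin Ig.
move: I2oo I2_ge0; case: (iint (fun x => (f2 x)%:E)) => [I||]// _; rewrite lee_fin => I0.
rewrite -!EFinM !lte_fin mulr_gt0// ltry => /(_ isT).
rewrite !poweR_EFin -?EFinM.
have -> : k `^ al * c * I = ((k * c * I) `^ al * I `^ be) * c `^ be.
  rewrite (powRM _ (mulr_ge0 (ltW k0) (ltW c0)) I0) (powRM _ (ltW k0) (ltW c0)).
  have -> : k `^ al * c `^ al * I `^ al * I `^ be * c `^ be =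
      k `^ al * ((c `^ al * c `^ be) * (I `^ al * I `^ be)) by ring.
  by rewrite -!powRD ?ab1 ?oner_eq0// !powRr1 ?(ltW c0)// mulrA.
rewrite (powRM _ (ltW c0) (ltW G0)) [c `^ be * _]mulrC.
rewrite (EFinM (_ * I `^ be)) (EFinM (G `^ be)) muleA.
by rewrite lee_pmul2r// ?fin_numE// lte_fin powR_gt0.
Qed.

End LowerBound.

Section Breve.
Context {R : realType}.

Lemma iint0 n : iint (fun _ : 'rV[R]_n => 0%E) = 0%E :> \bar R.
Proof. by elim: n => //= n IH; under eq_integral do rewrite IH; rewrite integral0. Qed.

(* [Fbreve] takes the junk value [0] where the supremum is infinite. *)
Lemma Fbreve_gt0_mono (F1 F2 : R -> R) (s t : R) :
  (forall t, 0 < F1 t) -> (forall t, 0 < F2 t) -> s <= t ->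
  0 < Fbreve F1 F2 s -> 0 < Fbreve F1 F2 t.
Proof.
move=> F1_gt0 F2_gt0 st; rewrite /Fbreve; set Ss := ereal_sup _; set St := ereal_sup _ => s0.
have tle : (St <= Ss)%E.
  by apply: le_ereal_sup => _ [q /= qP <-]; exists q => //=; exact: le_trans qP.
have tge : (0 < St)%E.
  apply: (@lt_le_trans _ _ (Num.sqrt (F1 t * F2 t))%:E).
    by rewrite lte_fin sqrtr_gt0 mulr_gt0.
  by apply: ereal_sup_ubound; exists (t, t) => //=; lra.
apply: fine_gt0; rewrite tge/=; apply: le_lt_trans tle _.
by case: Ss s0 => [r||] /=; rewrite ?ltry ?ltxx.
Qed.

Lemma Fbreve_gt0 n (F1 F2 : R -> R) (t : R) :
  (forall t, 0 < F1 t) -> (forall t, 0 < F2 t) ->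
  log_concave (fun x : 'rV[R]_n => Fbreve F1 F2 (sqn x / 2)) ->
  (0 < Iball n (Fbreve F1 F2) 1)%E -> 0 <= t -> 0 < Fbreve F1 F2 t.
Proof.
move=> F1_gt0 F2_gt0 [ge0 lc] I0 t0; apply: (Fbreve_gt0_mono F1_gt0 F2_gt0 t0).
rewrite lt_def.
have := ge0 0; rewrite sqn0 mul0r => ->; rewrite andbT.
apply: contraTneq I0 => F0; rewrite -leNgt.
have F00 (x : 'rV[R]_n) : Fbreve F1 F2 (sqn x / 2) = 0.
  apply/eqP; rewrite eq_le ge0 andbT.
  have h : 0 < (2^-1 : R) < 1 by lra.
  have := lc x (- x) 2^-1 h; rewrite sqnN.
  have -> : 1 - 2^-1 = 2^-1 :> R by field.
  rewrite scalerN subrr sqn0 mul0r F0 -expr2 -powR_mulrn ?powR_ge0// -powRrM.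
  by rewrite mulVf// powRr1.
rewrite /Iball /intR (_ : (fun x => _) = fun=> 0%E) ?iint0//.
by apply/funext => x; rewrite asboolT// expr1n mul1r F00.
Qed.

End Breve.

Theorem theorem2p6 (R : realType) (n : nat) (F1 F2 : R -> R)
    (psi : 'rV[R]_n -> \bar R) (p : R) :
  (0 < n)%N ->
  (forall t, 0 < F1 t) -> (forall t, 0 < F2 t) ->
  measurable_fun [set: R] F1 -> measurable_fun [set: R] F2 ->
  classC0 F1 F2 psi ->
  (0 < I_on psi (Fcomp F1 psi) < +oo)%E ->
  (0 < I_on (legendre psi) (Fcomp F2 (legendre psi)) < +oo)%E ->
  log_concave (Fcomp F1 psi) ->
  log_concave (Fcomp F2 (legendre psi)) ->
  log_concave (fun x : 'rV[R]_n => Fbreve F1 F2 (sqn x / 2)) ->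
  (0 < Iball n (Fbreve F1 F2) 1 < +oo)%E ->
  0 < p ->
  (Gfun p F1 F2 psi * Gfun p F2 F1 (legendre psi)
     <= Gfun p (Fbreve F1 F2) (Fbreve F1 F2) (@halfsq R n)
        * Gfun p (Fbreve F1 F2) (Fbreve F1 F2) (@halfsq R n))%E /\
  (strictly_decreasing (Fbreve F1 F2) ->
   ((Gfun p F1 F2 psi * Gfun p F2 F1 (legendre psi)
      = Gfun p (Fbreve F1 F2) (Fbreve F1 F2) (@halfsq R n)
        * Gfun p (Fbreve F1 F2) (Fbreve F1 F2) (@halfsq R n))%E
    <-> condE psi F1 F2)).
Proof.
move=> n_gt0 F1_gt0 F2_gt0 _ _ [cC [BS BSeq]] I1P I2P lc1 lc2 lcb IbP p0.
have p_ge0 := ltW p0.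
have F2l y : (legendre psi y < +oo)%E -> 0 < Fcomp F2 (legendre psi) y.
  have [x1 [r1 [r10 r1P]]] := cC.2.
  have [a psix1] : exists a, psi x1 = a%:E by apply: (int_dom_fin cC.1); exists r1.
  have := (legendre_convex cC.1 psix1).1 y; rewrite /Fcomp.
  by case: (legendre psi y).
have G1 := Gfun_le_legendre F1 p_ge0 cC.1 F2l lc2 I2P.
have G2 := Gfun_le_dual F2 p_ge0 F1_gt0 cC lc1 I1P.
have n0 : 0 < n%:R :> R by rewrite ltr0n.
have np0 : 0 < n%:R + p by rewrite addr_gt0.
have ab1 : n%:R / (n%:R + p) + p / (n%:R + p) = 1 by field; rewrite gt_eqF.
have powE (a b : \bar R) : (0 < a < +oo)%E -> (0 < b < +oo)%E ->
    (a `^ (n%:R / (n%:R + p)) * b `^ (p / (n%:R + p)) *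
     (b `^ (n%:R / (n%:R + p)) * a `^ (p / (n%:R + p))) = a * b)%E.
  move=> /gt0_lty_EFin[{}a a0 ->] /gt0_lty_EFin[{}b b0 ->]; rewrite !poweR_EFin -!EFinM; congr EFin.
  set al := n%:R / _ in ab1 *; set be := p / _ in ab1 *.
  have -> : a `^ al * b `^ be * (b `^ al * a `^ be) =
      (a `^ al * a `^ be) * (b `^ al * b `^ be) by ring.
  by rewrite -!powRD ?ab1 ?oner_eq0// !powRr1 ?ltW.
have GG_le : (Gfun p F1 F2 psi * Gfun p F2 F1 (legendre psi) <=
    I_on psi (Fcomp F1 psi) * I_on (legendre psi) (Fcomp F2 (legendre psi)))%E.
  by rewrite -(powE _ _ I1P I2P); apply: lee_pmul => //; exact: Gfun_ge0.
set Fb := Fbreve F1 F2.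
have Fb_gt0 t : 0 <= t -> 0 < Fb t.
  by apply: (Fbreve_gt0 F1_gt0 F2_gt0 lcb); have /andP[] := IbP.
have pH : posdef (2^-1%:M : 'M[R]_n).
  split=> [|x x0]; first exact: tr_scalar_mx.
  rewrite mul_mx_scalar dotvZl mulr_gt0 ?invr_gt0// lt_def sqn_ge0 andbT.
  by apply: contra_neq x0; exact: sqn_eq0.
have halfE : @halfsq R n = quad 2^-1%:M 0.
  by apply/funext => x; rewrite /quad mul_mx_scalar dotvZl addr0 mulrC.
have leghalf : legendre (@halfsq R n) = halfsq.
  rewrite halfE legendre_quad// oppr0 invmx_scalar scale_scalar_mx invrK.
  by congr (quad _%:M _); field.
have FbE : Fcomp Fb (@halfsq R n) = fun x => Fb (sqn x / 2) by [].
have IbE : I_on (@halfsq R n) (Fcomp Fb halfsq) = Iball n Fb 1.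
  rewrite halfE I_on_quad// -halfE /Iball /intR; congr iint; apply/funext => x.
  by rewrite asboolT// FbE expr1n mul1r.
have powb : (Iball n Fb 1 `^ (n%:R / (n%:R + p)) *
             Iball n Fb 1 `^ (p / (n%:R + p)) = Iball n Fb 1)%E.
  have [b b0 ->] := gt0_lty_EFin IbP; rewrite !poweR_EFin -EFinM -powRD ?ab1 ?oner_eq0//.
  by rewrite powRr1 ?ltW.
have Gb : Gfun p Fb Fb (@halfsq R n) = Iball n Fb 1.
  apply/eqP; rewrite eq_le; apply/andP; split.
    rewrite -powb -[in X in (_ <= X)%E]IbE -{4 5}leghalf.
    apply: Gfun_le_legendre => //; rewrite ?leghalf ?IbE ?FbE//.
    - by rewrite halfE; exact: quad_convex.
    - by move=> y _; apply: Fb_gt0; rewrite divr_ge0 ?sqn_ge0.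
  have := @Gfun_quad_ge _ n p Fb Fb 2^-1%:M 0 1 n_gt0 p0 pH ltr01.
  rewrite -halfE leghalf IbE powb; apply=> //.
  - by move=> t _; rewrite addr0 subr0 mul1r.
  - by move=> t t0; rewrite subr0; exact: Fb_gt0.
  - by have /andP[] := IbP.
rewrite Gb; split; first exact: le_trans GG_le BS.
move=> dec; have {BSeq} BSeq := BSeq dec.
have nz1 : I_on psi (Fcomp F1 psi) != 0%E by rewrite gt_eqF//; have /andP[] := I1P.
have nz2 : I_on (legendre psi) (Fcomp F2 (legendre psi)) != 0%E.
  by rewrite gt_eqF//; have /andP[] := I2P.
have {BSeq} BSeq := BSeq nz1 nz2; split => [GGE|cE].
  by apply/BSeq/eqP; rewrite eq_le BS/= -GGE.
rewrite -(BSeq.2 cE); apply/eqP; rewrite eq_le GG_le/= -(powE _ _ I1P I2P).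
have [b [a [A [b0 [sA [pA0 [psiE FE]]]]]]] := cE.
have pA : posdef A by [].
have psiQ : psi = quad A a by apply/funext => x; rewrite psiE.
have psi2 : legendre (legendre psi) = psi.
  apply/funext => x; apply: bilegendre_int; first exact: cC.1.
  by exists 1 => // y _; rewrite psiE ltry.
have b20 : 0 < b ^+ 2 by rewrite exprn_gt0.
have F12 t : 0 <= t -> F1 (t + a) = b ^+ 2 * F2 (t - a).
  by move=> /FE[-> <-]; rewrite mulrA expr2.
have legE : legendre psi = quad (4^-1 *: invmx A) (- a) by rewrite psiQ legendre_quad.
have pB : posdef (4^-1 *: invmx A) by apply: posdefZ => //; exact: posdef_inv.
apply: lee_pmul; rewrite ?mule_ge0 ?poweR_ge0//.
  rewrite psiQ; apply: (@Gfun_quad_ge _ n p F1 F2 A a (b ^+ 2)) => //; rewrite -?psiQ//.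
  by have /andP[] := I2P.
have := @Gfun_quad_ge _ n p F2 F1 (4^-1 *: invmx A) (- a) (b ^+ 2)^-1.
rewrite /= -legE psi2; apply => //.
- by rewrite invr_gt0.
- by move=> t t0; rewrite opprK F12// mulKf// gt_eqF.
- by have /andP[] := I1P.
Qed.
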